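(* Assume (A.1), (A.2), (A.3), (A.4) and (A.6), and let $(x_k)_{k\in\mathbb N}$ be a sequence generated by the ICGALP algorithm with parameters and errors satisfying (P.1)–(P.6) and (P.8) (algorithm and assumptions as listed in the context). Let $\Gamma_k=\sum_{i=0}^k\gamma_i$. Then: (i) Asymptotic feasibility: $\lim_{k\to\infty}\|Ax_k-b\|=0$ almost surely. (ii) Pointwise rate: $\inf_{0\le i\le k}\|Ax_i-b\|=O\big(1/\sqrt{\Gamma_k}\big)$ almost surely, and almost surely there exists a subsequence $(x_{k_j})_{j\in\mathbb N}$ such that $\|Ax_{k_j}-b\|\le 1/\sqrt{\Gamma_{k_j}}$ for all $j$. (iii) Ergodic rate: with $\bar x_k=\sum_{i=0}^k\gamma_i x_i/\Gamma_k$, one has $\|A\bar x_k-b\|=O\big(1/\sqrt{\Gamma_k}\big)$ almost surely.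
   Context: **Setting.** $\mathcal H_p,\mathcal H_d,\mathcal H_v$ are real Hilbert spaces (possibly infinite-dimensional); $A:\mathcal H_p\to\mathcal H_d$ and $T:\mathcal H_p\to\mathcal H_v$ are bounded linear operators; $b\in\operatorname{ran}(A)$; $f,h$ (on $\mathcal H_p$) and $g$ (on $\mathcal H_v$) are convex, closed (lower semicontinuous), proper functions. The primal problem is $\min_{x\in\mathcal H_p}\{f(x)+g(Tx)+h(x): Ax=b\}$. Put $\mathcal C=\operatorname{dom}(h)$. The Lagrangian is $\mathcal L(x,\mu)=f(x)+g(Tx)+h(x)+\langle\mu,Ax-b\rangle$. **Algorithm (ICGALP).** Let $(\Omega,\mathcal F,\mathbb P)$ be a probability space, $\lambda_k:\Omega\to\mathcal H_p$ and $\lambda_k^s:\Omega\to[0,+\infty[$ random variables (the errors). Given $x_0\in\mathcal C$, $\mu_0\in\operatorname{ran}(A)$ and nonnegative real sequences $(\gamma_k),(\beta_k),(\theta_k),(\rho_k)$, iterate for $k=0,1,2,\dots$: - $y_k=\operatorname{prox}_{\beta_k g}(Tx_k)$, where $\operatorname{prox}_{\beta g}(v)=\operatorname{argmin}_w\{g(w)+\frac1{2\beta}\|v-w\|^2\}$; - $z_k=\nabla f(x_k)+T^*(Tx_k-y_k)/\beta_k+A^*\mu_k+\rho_kA^*(Ax_k-b)+\lambda_k$; - $s_k\in\operatorname{Argmin}_{s\in\mathcal H_p}\{h(s)+\langle z_k,s\rangle\}$; - $\widehat s_k\in\{s\in\mathcal H_p: h(s)+\langle z_k,s\rangle\le h(s_k)+\langle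 z_k,s_k\rangle+\lambda_k^s\}$; - $x_{k+1}=x_k-\gamma_k(x_k-\widehat s_k)$; - $\mu_{k+1}=\mu_k+\theta_k(Ax_{k+1}-b)$. Filtration: $\mathfrak S=(\mathcal S_k)_{k\in\mathbb N}$, $\mathcal S_k=\sigma(x_0,\mu_0,\widehat s_0,\dots,\widehat s_k)$ (so $x_{k+1},\mu_{k+1}$ are $\mathcal S_k$-measurable). $\ell^1_+$ is the set of nonnegative summable real sequences; $\ell^1_+(\mathfrak S)$ is the set of sequences $(a_k)$ of $[0,+\infty[$-valued random variables, $a_k$ being $\mathcal S_k$-measurable, with $\sum_k a_k<+\infty$ almost surely. **$(F,\zeta)$-smoothness.** Let $F:\mathcal H_p\to\mathbb R\cup\{+\infty\}$ and $\zeta:]0,1]\to[0,+\infty[$. The pair $(f,\mathcal C)$ with $\mathcal C\subset\operatorname{dom}(f)$ is $(F,\zeta)$-smooth if there is an open set $\mathcal C_0$ with $\mathcal C\subset\mathcal C_0\subset\operatorname{int}(\operatorname{dom}F)$ such that $F$ and $f$ are differentiable on $\mathcal C_0$, $F-f$ is convex on $\mathcal C_0$, and $$K_{(F,\zeta,\mathcal C)}=\sup\Big\{\tfrac{D_F(z,x)}{\zeta(\gamma)}: x,s\in\mathcal C,\ \gamma\in]0,1],\ z=x+\gamma(s-x)\Big\}<+\infty,$$ where $D_F(z,x)=F(z)-F(x)-\langle\nabla F(x),z-x\rangle$. **Assumptions on the functions.** - (A.1) $f$, $g\circ T$ and $h$ are proper, convex, lower semicontinuous on $\mathcal H_p$.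 - (A.2) $(f,\mathcal C)$ is $(F,\zeta)$-smooth. - (A.3) $\mathcal C$ is weakly compact (and thus contained in a ball of radius $R>0$). - (A.4) $T\mathcal C\subset\operatorname{dom}(\partial g)$ and $M=\sup_{x\in\mathcal C}\|[\partial g(Tx)]^0\|<\infty$, where $[\partial g(v)]^0$ is the minimal-norm element of $\partial g(v)$. - (A.6) There exists a saddle point $(x^\star,\mu^\star)\in\mathcal H_p\times\mathcal H_d$ of $\mathcal L$. **Assumptions on parameters and errors.** - (P.1) $(\gamma_k)\subset]0,1]$ and $(\zeta(\gamma_k)),(\gamma_k^2/\beta_k),(\gamma_k\beta_k)\in\ell^1_+$. - (P.2) $(\gamma_k)\notin\ell^1$. - (P.3) $(\beta_k)$ is nonincreasing and converges to $0$. - (P.4) $(\rho_k)$ is nondecreasing with $0<\underline\rho\le\rho_k\le\overline\rho<+\infty$. - (P.5) There are constants $\underline M,\overline M>0$ with $\underline M\le\gamma_k/\gamma_{k+1}\le\overline M$ for all $k$. - (P.6) $\theta_k=\gamma_k/c$ for some $c>0$ with $\overline M/c-\underline\rho/2<0$. - (P.8) $(\gamma_{k+1}\mathbb E[\|\lambda_{k+1}\|\mid\mathcal S_k])_k\in\ell^1_+(\mathfrak S)$ and $(\gamma_{k+1}\mathbb E[\lambda^s_{k+1}\mid\mathcal S_k])_k\in\ell^1_+(\mathfrak S)$. *)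

(* Defs.v *)
From HB Require Import structures.
From mathcomp Require Import all_boot all_order all_algebra.
From mathcomp Require Import all_classical all_reals all_analysis.

Set Implicit Arguments.
Unset Strict Implicit.
Unset Printing Implicit Defensive.

Import Order.TTheory GRing.Theory Num.Theory.
Import numFieldNormedType.Exports.

Local Open Scope classical_set_scope.
Local Open Scope ring_scope.

HB.mixin Record NormedModule_hasInner (R : realType) V of NormedModule R V := {
  inner : V -> V -> R;
  innerC : forall u v, inner u v = inner v u;
  innerDl : forall u v w, inner (u + v) w = inner u w + inner v w;
  innerZl : forall (a : R) u v, inner (a *: u) v = a * inner u v;
  inner_norm : forall u : V, inner u u = `|u| ^+ 2
}.

#[short(type="hilbertType")]
HB.structure Definition Hilbert (R : realType) :=
  {V of CompleteNormedModule R V & NormedModule_hasInner R V}.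

Section hilbert.
Context {R : realType}.

(* Coarsest topology for which every <u, .> is continuous. *)
Definition weak_topology_of (V : hilbertType R) : topologicalType :=
  sup_topology (fun u : V => Topological.on (initial_topology (inner u))).

Definition weakly_compact (V : hilbertType R) (C : set V) :=
  @compact (weak_topology_of V) C.

(* The value 0 of [xget] is never used when B is linear and continuous, by the
   Riesz representation theorem. *)
Definition adjoint (V W : hilbertType R) (B : V -> W) (w : W) : V :=
  xget 0 [set u : V | forall v, inner (B v) w = inner v u].

(* Likewise, the value 0 is only used when C has no element of minimal norm,
   which does not happen for C nonempty, closed and convex. *)
Definition min_norm_element (V : hilbertType R) (C : set V) : V :=
  xget 0 [set u | C u /\ forall v, C v -> `|u| <= `|v|].

End hilbert.

(** Functions with values in R U {+oo} are represented by functions into \bar R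
    that do not take the value -oo. *)
Section extended_functions.
Context {R : realType}.
Local Open Scope ereal_scope.

Definition dom (T : Type) (f : T -> \bar R) : set T := [set x | f x < +oo].

Definition proper (T : Type) (f : T -> \bar R) :=
  (forall x, -oo < f x) /\ dom f !=set0.

Definition econvex (V : lmodType R) (f : V -> \bar R) :=
  forall (x y : V) (t : R), (0 < t < 1)%R ->
    f (t *: x + (1 - t) *: y)%R <= t%:E * f x + (1 - t)%:E * f y.

Definition closed_convex_proper (V : hilbertType R) (f : V -> \bar R) :=
  [/\ proper f, econvex f & lower_semicontinuous f].

Definition argmin (T : Type) (f : T -> \bar R) : set T :=
  [set x | forall w, f x <= f w].

Definition prox_objective (V : hilbertType R) (beta : R) (g : V -> \bar R)
    (v : V) : V -> \bar R :=
  fun w => g w + ((2 * beta)^-1 * `|v - w| ^+ 2)%:E.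

Definition subdifferential (V : hilbertType R) (g : V -> \bar R) (v : V) :
    set V :=
  [set u | forall w, g v + (inner u (w - v)%R)%:E <= g w].

(* Meant for open C, where finiteness on C is finiteness near each point. *)
Definition differentiable_on (V : hilbertType R) (f : V -> \bar R)
    (C : set V) :=
  forall x, C x ->
    f x \is a fin_num /\ differentiable (fine \o f : V -> R^o) x.

Definition gradient (V : hilbertType R) (f : V -> \bar R) (x : V) : V :=
  xget 0%R [set u : V |
    forall v, 'd (fine \o f : V -> R^o) x v = inner u v :> R].

Definition bregman (V : hilbertType R) (F : V -> \bar R) (z x : V) : R :=
  (fine (F z) - fine (F x) - inner (gradient F x) (z - x))%R.

(* Only points of C are compared, so that C need not be convex. *)
Definition convex_on (V : lmodType R) (C : set V) (f : V -> R) :=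
  forall (x y : V) (t : R), (0 < t < 1)%R ->
    C x -> C y -> C (t *: x + (1 - t) *: y)%R ->
    (f (t *: x + (1 - t) *: y) <= t * f x + (1 - t) * f y)%R.

(* The division is that of \bar R: r / 0 = +oo for r > 0 and 0 / 0 = 0, so that
   a zero of zeta forces D_F to vanish instead of discarding the constraint. *)
Definition smoothness_constant (V : hilbertType R) (F : V -> \bar R)
    (zeta : R -> R) (C : set V) : \bar R :=
  ereal_sup [set q | exists x s (gamma : R),
    [/\ C x, C s, (0 < gamma <= 1)%R &
        q = (bregman F (x + gamma *: (s - x))%R x)%:E / (zeta gamma)%:E]].

Definition FZ_smooth (V : hilbertType R) (F : V -> \bar R) (zeta : R -> R)
    (f : V -> \bar R) (C : set V) :=
  C `<=` dom f /\
  exists C0 : set V,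
    [/\ open C0, C `<=` C0 /\ C0 `<=` interior (dom F),
        differentiable_on F C0 /\ differentiable_on f C0,
        convex_on C0 (fun x => fine (F x) - fine (f x))%R &
        smoothness_constant F zeta C < +oo].

End extended_functions.

Section problem.
Context {R : realType} {Hp Hd Hv : hilbertType R}.
Variables (f : Hp -> \bar R) (g : Hv -> \bar R) (h : Hp -> \bar R).
Variables (T : {linear Hp -> Hv}) (A : {linear Hp -> Hd}) (b : Hd).

Definition lagrangian (x : Hp) (mu : Hd) : \bar R :=
  (f x + g (T x) + h x + (inner mu (A x - b)%R)%:E)%E.

Definition saddle_point (xs : Hp) (mus : Hd) :=
  forall x mu, (lagrangian xs mu <= lagrangian xs mus)%E /\
               (lagrangian xs mus <= lagrangian x mus)%E.

(* A realization of the algorithm: lam and lams are the errors lambda_k and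
   lambda^s_k. *)
Record icgalp (gamma beta theta rho : nat -> R)
    (lam : nat -> Hp) (lams : nat -> R)
    (x : nat -> Hp) (mu : nat -> Hd) (y : nat -> Hv) (z s shat : nat -> Hp) :
    Prop := Icgalp {
  icgalp_x0 : dom h (x 0%N);
  icgalp_mu0 : range A (mu 0%N);
  icgalp_y : forall k, argmin (prox_objective (beta k) g (T (x k))) (y k);
  icgalp_z : forall k, z k =
    gradient f (x k) + (beta k)^-1 *: adjoint T (T (x k) - y k)
    + adjoint A (mu k) + rho k *: adjoint A (A (x k) - b) + lam k;
  icgalp_s : forall k, argmin (fun u => h u + (inner (z k) u)%:E)%E (s k);
  icgalp_shat : forall k,
    (h (shat k) + (inner (z k) (shat k))%:E
       <= h (s k) + (inner (z k) (s k))%:E + (lams k)%:E)%E;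
  icgalp_x : forall k, x k.+1 = x k - gamma k *: (x k - shat k);
  icgalp_mu : forall k, mu k.+1 = mu k + theta k *: (A (x k.+1) - b)
}.

End problem.

Definition ell1_plus {R : realType} (u : nat -> R) :=
  (forall k, 0 <= u k) /\ cvgn (series u).

Section probability.
Context {R : realType} {d : measure_display} {Omega : measurableType d}.
Variable P : probability Omega R.

(* V with its Borel sigma-algebra *)
Definition borel (V : hilbertType R) := g_sigma_algebraType (@open V).

Definition generated_by (V : hilbertType R) (X : Omega -> V) :
    set (set Omega) :=
  preimage_set_system [set: Omega] X (@measurable _ (borel V)).

(* A generating family of S_k = sigma(x_0, mu_0, shat_0, ..., shat_k); the
   sigma-algebra itself is carried by [g_sigma_algebraType]. *)
Definition history (V W : hilbertType R) (x0 : Omega -> V) (mu0 : Omega -> W)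
    (shat : nat -> Omega -> V) (k : nat) : set (set Omega) :=
  generated_by x0 `|` generated_by mu0
  `|` \bigcup_(i in `I_k.+1) generated_by (shat i).

Definition measurable_wrt (G : set (set Omega)) (Y : Omega -> R) :=
  measurable_fun [set: g_sigma_algebraType G] (Y : g_sigma_algebraType G -> R).

(* Y is a [0, +oo[-valued version of E[X | sigma(G)], for X >= 0 that need not
   be integrable. *)
Definition cond_expectation_version (G : set (set Omega)) (X Y : Omega -> R) :=
  [/\ forall w, 0 <= Y w, measurable_wrt G Y &
      forall B, <<s G >> B ->
        (\int[P]_(w in B) (Y w)%:E = \int[P]_(w in B) (X w)%:E)%E].

Definition ell1_plus_adapted (G : nat -> set (set Omega))
    (a : nat -> Omega -> R) :=
  (forall k, (forall w, 0 <= a k w) /\ measurable_wrt (G k) (a k)) /\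
  {ae P, forall w, cvgn (series (a ^~ w))}.

(* (c_k E[X_k | sigma(G_k)])_k belongs to l^1_+(G) *)
Definition summable_cond_expectation (G : nat -> set (set Omega))
    (c : nat -> R) (X : nat -> Omega -> R) :=
  exists e : nat -> Omega -> R,
    (forall k, cond_expectation_version (G k) (X k) (e k)) /\
    ell1_plus_adapted G (fun k w => c k * e k w).

End probability.

Definition partial_sum {R : realType} (gamma : nat -> R) (k : nat) : R :=
  \sum_(0 <= i < k.+1) gamma i.

Definition ergodic_mean {R : realType} {V : hilbertType R}
    (gamma : nat -> R) (x : nat -> V) (k : nat) : V :=
  (partial_sum gamma k)^-1 *: \sum_(0 <= i < k.+1) gamma i *: x i.

(* Main.v *)
Require Import Defs.
From HB Require Import structures.
From mathcomp Require Import all_boot all_order all_algebra.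
From mathcomp Require Import all_classical all_reals all_analysis.
From mathcomp Require Import measurable_realfun ring lra.

Set Implicit Arguments.
Unset Strict Implicit.
Unset Printing Implicit Defensive.

Import Order.TTheory GRing.Theory Num.Theory.
Import numFieldNormedType.Exports.

Local Open Scope classical_set_scope.
Local Open Scope ring_scope.

(** Almost every trajectory has summable errors: a sequence of nonnegative random
    variables whose conditional expectations given the past are summable is
    itself summable almost surely ([conditional_summable], a stopping argument).
    From then on everything is deterministic, and all three conclusions follow
    from the single fact that the infeasibilities a_k = A x_k - b satisfy
      sum_k gamma_k |a_k|^2 < +oo            ([infeasibility_bounded_sums]).
    Indeed the gamma_k are not summable; together with |a_(k+1)|^2 <= |a_k|^2 +
    O(gamma_k) and the summability of gamma_k^2 this forces a_k -> 0. The best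
    iterate satisfies Gamma_k min_i |a_i|^2 <= sum_i gamma_i |a_i|^2, the ergodic
    mean satisfies the same bound by Jensen's inequality, and |a_k|^2 > 1 / Gamma_k
    for all large k would contradict the divergence of sum_k gamma_k / Gamma_k.

    For the weighted summability, consider the smoothed augmented Lagrangian in
    which the variable w of the smoothed term g(w) + |T u - w|^2 / (2 beta_k) is
    kept as a second primal variable ([smoothed_lagrangian]). Let P_k be its value
    at (x_k, y_k, mu_k), D_k its infimum over the primal variables at mu_k, and
    r_k = A u_k - b for an almost-minimizer (u_k, w_k).
    - Along a step the value at mu_k decreases from P_k by gamma_k (P_k - D_k) +
      gamma_k rho_k / 2 |a_k - r_k|^2 up to a summable error
      ([conditional_gradient_step]). The optimality of y_k gives the two
      first-order bounds on the smoothed term, and (F, zeta)-smoothness replaces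
      the descent lemma for f ([FZ_smooth_descent]).
    - Changing beta, rho and mu adds a telescoping error and theta_k |a_(k+1)|^2
      ([lagrangian_update]).
    - The Lagrangian grows with k, so D_(k+1) >= D_k + theta_k <a_(k+1), r_(k+1)>
      up to the tolerance of the almost-minimizer.
    Hence P_k - 2 D_k is a Lyapunov function: it decreases by
    gamma_k rho_k / 2 |a_k - r_k|^2 and changes by theta_k (|a_(k+1) - r_(k+1)|^2 -
    |r_(k+1)|^2), whose positive part is absorbed by the decrease of the following
    step because theta_k <= (M_sup / c) gamma_(k+1) and M_sup / c < rho_inf / 2. So
    both gamma_k |a_k - r_k|^2 and gamma_k |r_k|^2 are summable. Weak compactness
    of dom h enters through boundedness ([weakly_compact_bounded], an instance of
    the uniform boundedness principle), which makes the error terms uniform. *)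

(** * Hilbert spaces *)

Section inner_product.
Context {R : realType} {V : hilbertType R}.
Implicit Types u v w : V.

Lemma innerDr u v w : inner u (v + w) = inner u v + inner u w.
Proof. by rewrite innerC innerDl ![inner _ u]innerC. Qed.

Lemma innerZr (a : R) u v : inner u (a *: v) = a * inner u v.
Proof. by rewrite innerC innerZl innerC. Qed.

Lemma innerNl u v : inner (- u) v = - inner u v.
Proof. by rewrite -scaleN1r innerZl mulN1r. Qed.

Lemma innerNr u v : inner u (- v) = - inner u v.
Proof. by rewrite innerC innerNl innerC. Qed.

Lemma innerBr u v w : inner u (v - w) = inner u v - inner u w.
Proof. by rewrite innerDr innerNr. Qed.

Lemma inner0r u : inner u 0 = 0.
Proof. by rewrite -(scale0r (0 : V)) innerZr mul0r. Qed.

Lemma inner0l u : inner 0 u = 0.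
Proof. by rewrite innerC inner0r. Qed.

Definition innerE :=
  (@innerDl R V, innerDr, @innerZl R V, innerZr, innerNl, innerNr).

Lemma normD_sqr u v : `|u + v| ^+ 2 = `|u| ^+ 2 + 2 * inner u v + `|v| ^+ 2.
Proof. by rewrite -!inner_norm !innerE [inner v u]innerC; ring. Qed.

Lemma normB_sqr u v : `|u - v| ^+ 2 = `|u| ^+ 2 - 2 * inner u v + `|v| ^+ 2.
Proof. by rewrite normD_sqr innerNr normrN mulrN. Qed.

Lemma normZ_sqr (a : R) u : `|a *: u| ^+ 2 = a ^+ 2 * `|u| ^+ 2.
Proof. by rewrite normrZ exprMn real_normK// num_real. Qed.

Lemma CauchySchwarz_sqr u v : inner u v ^+ 2 <= `|u| ^+ 2 * `|v| ^+ 2.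
Proof.
have [->|v0] := eqVneq v 0; first by rewrite inner0r normr0 expr0n/= mulr0.
have v2 : 0 < `|v| ^+ 2 by rewrite exprn_gt0// normr_gt0.
have := sqr_ge0 `|(`|v| ^+ 2) *: u - inner u v *: v|.
rewrite normB_sqr !normZ_sqr innerZl innerZr.
set a := inner u v; set p := `|v| ^+ 2; set q := `|u| ^+ 2 => H.
have {}H : 0 <= p * (q * p - a ^+ 2).
  by apply: le_trans H _; rewrite le_eqVlt; apply/orP; left; apply/eqP; ring.
by rewrite pmulr_rge0// subr_ge0 in H.
Qed.

Lemma CauchySchwarz u v : `|inner u v| <= `|u| * `|v|.
Proof.
rewrite -(@ler_pXn2r _ 2)// ?nnegrE ?mulr_ge0//.
by rewrite exprMn real_normK ?num_real// CauchySchwarz_sqr.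
Qed.

Lemma ler_inner u v : inner u v <= `|u| * `|v|.
Proof. exact: le_trans (ler_norm _) (CauchySchwarz u v). Qed.

Let inner_linear u : linear (inner u : V -> R^o).
Proof. by move=> a v w; rewrite innerDr innerZr. Qed.

HB.instance Definition _ u :=
  GRing.isLinear.Build R V R^o *:%R (inner u : V -> R^o) (inner_linear u).

Lemma inner_continuous u : continuous (inner u : V -> R^o).
Proof.
apply: bounded_linear_continuous; apply/linear_boundedP.
near=> r => x /=; apply: le_trans (CauchySchwarz u x) _.
by apply: ler_wpM2r => //; near: r; exact: nbhs_pinfty_ge.
Unshelve. all: by end_near. Qed.

End inner_product.

Section projection.
Context {R : realType} {V : hilbertType R}.
Implicit Types (u v : V) (C : set V).

(** The near-minimizers of the norm form a Cauchy filter by the parallelogram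
    law: the midpoint of two of them is in C, hence not shorter than the
    infimum, so that they must be close to each other. *)
Lemma exists_min_norm C : C !=set0 -> closed C ->
  (forall u v, C u -> C v -> C (2^-1 *: (u + v))) ->
  exists u, C u /\ forall v, C v -> `|u| <= `|v|.
Proof.
move=> [v0 Cv0] clC midC.
pose S := [set `|v| | v in C]; pose m := inf S.
have S0 : S !=set0 by exists `|v0|, v0.
have lbS : has_lbound S by exists 0 => _ [v _ <-].
have m_le v : C v -> m <= `|v| by move=> Cv; apply: ge_inf => //; exists v.
have m0 : 0 <= m by apply: lb_le_inf => // _ [v _ <-].
pose B (e : R) := [set v | C v /\ `|v| < m + e].
pose F : set_system V := filter_from [set e : R | 0 < e] B.
have B0 e : 0 < e -> B e !=set0.
  move=> e0; have [|_ [v Cv <-] vm] := @inf_adherent _ S e e0; last by exists v.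
  by split.
have FF : ProperFilter F.
  apply: filter_from_proper; last by move=> e /B0.
  apply: filter_from_filter; first by exists 1 => /=.
  move=> i j /= i0 j0; exists (Num.min i j); first by rewrite /= lt_min i0.
  by move=> v [Cv]; rewrite addr_minr lt_min => /andP[vi vj]; split; split.
have Fcvg : cvg F.
  apply: cauchy_cvg; apply: cauchy_exP => e e0.
  (* Two points of norm less than m + r are at squared distance less than
     4 (m + r)^2 - 4 m^2 = 8 m r + 4 r^2, which this r keeps below e^2. *)
  pose r := Num.min 1 (e ^+ 2 / (8 * m + 8)).
  have e2 : 0 < e ^+ 2 by rewrite exprn_gt0.
  have r0 : 0 < r by rewrite lt_min ltr01/= divr_gt0//; lra.
  have [p [Cp pm]] := B0 _ r0.
  exists p; exists r => // q [Cq qm]; rewrite -ball_normE/=.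
  rewrite -(@ltr_pXn2r _ 2)// ?nnegrE ?(ltW e0)//.
  have := m_le _ (midC _ _ Cp Cq).
  rewrite -(@ler_pXn2r _ 2)// ?nnegrE//.
  rewrite normZ_sqr normD_sqr normB_sqr exprVn => Hm.
  have r1 : r <= 1 by rewrite ge_min lexx.
  have re : r * (8 * m + 8) <= e ^+ 2.
    by rewrite -ler_pdivlMr ?ge_min ?lexx ?orbT//; lra.
  have p2 : `|p| ^+ 2 < (m + r) ^+ 2.
    by rewrite ltr_pXn2r// nnegrE// addr_ge0// ltW.
  have q2 : `|q| ^+ 2 < (m + r) ^+ 2.
    by rewrite ltr_pXn2r// nnegrE// addr_ge0// ltW.
  have rr : r ^+ 2 <= r by rewrite expr2 ler_piMl// ltW.
  move: p2 q2 re Hm; rewrite sqrrD.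
  set mr := m * r; rewrite mulrDr (_ : r * (8 * m) = 8 * mr); last first.
    by rewrite /mr; ring.
  move=> p2 q2 re Hm.
  have := Hm; rewrite (_ : (2 ^+ 2 : R) = 4); last by rewrite expr2; lra.
  lra.
exists (lim F); split.
  apply: (@closed_cvg _ _ F _ id C clC _ _ Fcvg).
  by exists 1 => [|v []] //=.
move=> v Cv; apply: le_trans (m_le _ Cv).
have nF : (fun v => `|v|) @ F --> `|lim F| by apply: cvg_norm.
apply/ler_addgt0Pr => e e0.
by apply: (cvgr_to_le nF); exists e => //= w [_ /ltW].
Qed.

Lemma ortho_of_min_norm u v :
  (forall t : R, `|u| <= `|u + t *: v|) -> inner u v = 0.
Proof.
move=> umin; have [->|v0] := eqVneq v 0; first by rewrite inner0r.
have v2 : 0 < `|v| ^+ 2 by rewrite exprn_gt0// normr_gt0.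
(* the step length minimizing the norm along the line *)
have := umin (- inner u v / `|v| ^+ 2).
rewrite -(@ler_pXn2r _ 2)// ?nnegrE// normD_sqr innerZr normZ_sqr.
set a := inner u v; set p := `|v| ^+ 2.
have -> : `|u| ^+ 2 + 2 * (- a / p * a) + (- a / p) ^+ 2 * p =
          `|u| ^+ 2 - a ^+ 2 / p by field; rewrite gt_eqF.
rewrite lerBrDr gerDl => a2.
apply/eqP; rewrite -sqrf_eq0 eq_le sqr_ge0 andbT.
by rewrite pmulr_lle0 ?invr_gt0// in a2.
Qed.

(** Riesz representation. The representing vector is normal to the kernel of the
    functional; it is found as the point of least norm of the level set at
    height 1. *)
Lemma riesz (phi : {linear V -> R^o}) :
  continuous phi -> exists u, forall v, phi v = inner u v.
Proof.
move=> phic; have [[v1 phi1]|phi0] := pselect (exists v, phi v != 0); last first.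
  exists 0 => v; rewrite inner0l; apply/eqP.
  by apply: contra_notT phi0 => pv; exists v.
pose C := [set v | phi v = 1].
have [||u v Cu Cv|u [Cu umin]] := @exists_min_norm C.
- by exists ((phi v1)^-1 *: v1); rewrite /C/= linearZ/= /GRing.scale/= mulVf.
- rewrite (_ : C = phi @^-1` [set 1]) //.
  apply: closed_comp; last exact: closed_eq.
  by move=> v _; exact: phic.
- rewrite /C/= linearZ/= linearD/= Cu Cv /GRing.scale/=; lra.
have ort v : phi v = 0 -> inner u v = 0.
  move=> pv; apply: ortho_of_min_norm => t; apply: umin.
  by rewrite /C/= linearD linearZ/= pv Cu /GRing.scale/= mulr0 addr0.
have u0 : `|u| ^+ 2 != 0.
  rewrite sqrf_eq0 normr_eq0; apply/eqP => u0.
  by move: Cu; rewrite u0 /C/= linear0 => /esym/eqP; rewrite oner_eq0.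
exists (`|u| ^- 2 *: u) => v.
have := ort (v - phi v *: u).
rewrite linearB/= linearZ/= Cu /GRing.scale/= mulr1 subrr => /(_ erefl).
rewrite innerBr innerZr inner_norm innerZl => /eqP.
by rewrite subr_eq0 => /eqP ->; rewrite mulrC mulfK.
Qed.

End projection.

Lemma continuous_linear_bound {R : realType} {V W : normedModType R}
    (B : {linear V -> W}) :
  continuous B -> exists2 K : R, 0 < K & forall v, `|B v| <= K * `|v|.
Proof.
move=> Bc; have /(_ 0)/continuous_linear_bounded Bb := Bc.
have /linear_boundedP/pinfty_ex_gt0[K K0 BK] := Bb 0.
by exists K.
Qed.

Lemma adjointP {R : realType} {V W : hilbertType R} (B : {linear V -> W}) v w :
  continuous B -> inner (adjoint B w) v = inner w (B v).
Proof.
move=> Bc; rewrite innerC [RHS]innerC; apply/esym; move: v.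
rewrite /adjoint; case: xgetP => [u _ //|noadj].
pose phi v : R^o := inner w (B v).
have phil : linear phi by move=> a v v'; rewrite /phi linearP innerDr innerZr.
pose Phi : {linear V -> R^o} :=
  HB.pack phi (GRing.isLinear.Build _ _ _ _ _ phil).
have [|u uP] := @riesz _ _ Phi.
  by move=> v; apply: continuous_comp; [exact: Bc|exact: inner_continuous].
exfalso; apply: (noadj u) => v /=.
by rewrite innerC [RHS]innerC -uP.
Qed.

Lemma gradientP {R : realType} {V : hilbertType R} (f : V -> \bar R) x v :
  differentiable (fine \o f : V -> R^o) x ->
  'd (fine \o f : V -> R^o) x v = inner (gradient f x) v.
Proof.
move=> df; move: v; rewrite /gradient; case: xgetP => [u _ //|nograd].
have [|u uP] := @riesz _ _ ('d (fine \o f : V -> R^o) x).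
  exact: diff_continuous.
by exfalso; apply: (nograd u) => v /=; rewrite uP.
Qed.

(** The uniform boundedness principle for the functionals [inner ^~ c], c in C:
    each of them maps the weakly compact C onto a compact set of reals. *)
Lemma weakly_compact_bounded {R : realType} {V : hilbertType R} (C : set V) :
  weakly_compact C -> exists2 r : R, 0 < r & forall v, C v -> `|v| <= r.
Proof.
move=> Cc.
pose F := [set (inner c : V -> R^o) | c in C].
have [_ [c _ <-]|u|M MP] := @Banach_Steinhauss R V R^o F _ _ 1.
- split; last exact: linearP.
  move=> r; exists (`|c| * `|r|) => v vr; apply: le_trans (CauchySchwarz _ _) _.
  by rewrite ler_wpM2l// (le_trans vr)// ler_norm.
- have cu : continuous (inner u : weak_topology_of V -> R).
    move=> v; have /cvg_sup := @cvg_id _ (nbhs (v : weak_topology_of V)).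
    move=> /(_ u) /= Hu.
    have := @initial_continuous V R (inner u) v.
    move=> Hi A HA; exact: (Hu _ (Hi A HA)).
  have /compact_bounded : compact (inner u @` C).
    apply: (@continuous_compact (weak_topology_of V) R) => //.
    by apply: continuous_subspaceT.
  move=> /pinfty_ex_gt0[M M0 HM]; exists M => _ [c Cc' <-].
  by rewrite innerC; apply: HM; exists c.
exists (Num.max 1 M); first by rewrite lt_max ltr01.
move=> v Cv; rewrite le_max; apply/orP; right.
have [->|v0] := eqVneq v 0.
  by have := MP _ (imageP _ Cv) 0; rewrite inner0r !normr0; apply.
have := MP _ (imageP _ Cv) (`|v|^-1 *: v).
rewrite normrZ innerZr normfV normr_id mulVf ?normr_eq0//= => /(_ (lexx _)).
by rewrite inner_norm expr2 mulKf ?normr_eq0// normr_id.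
Qed.

(** * Convex functions, proximal points and (F, zeta)-smoothness *)

Lemma diff_le_of_increments {R : realType} {V : normedModType R}
    (phi : V -> R^o) (x v : V) (c : R) :
  differentiable phi x ->
  (forall t : R, 0 < t < 1 -> phi (x + t *: v) - phi x <= t * c) ->
  'd phi x v <= c.
Proof.
move=> dphi incr; rewrite -deriveE//.
have /cvg_dnbhs_at_right dcvg := @diff_derivable _ _ _ _ _ v dphi.
apply: (cvgr_to_le dcvg); near=> t.
have t0 : 0 < t by near: t; exact: nbhs_right_gt.
have t1 : t < 1 by near: t; exact: nbhs_right_lt.
have := incr t; rewrite t0 t1 => /(_ isT) le_t.
by rewrite /= /GRing.scale/= [t *: v + x]addrC mulrC ler_pdivrMr// mulrC.
Unshelve. all: by end_near. Qed.

Lemma convex_diff_le {R : realType} {V : normedModType R}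
    (phi : V -> R^o) (x z : V) :
  differentiable phi x ->
  (forall t : R, 0 < t < 1 ->
     phi (t *: z + (1 - t) *: x) <= t * phi z + (1 - t) * phi x) ->
  phi x + 'd phi x (z - x) <= phi z.
Proof.
move=> dphi conv; rewrite -lerBrDl; apply: diff_le_of_increments => // t t01.
rewrite (_ : x + t *: (z - x) = t *: z + (1 - t) *: x); last first.
  by rewrite scalerBr scalerBl scale1r addrCA addrA.
by have := conv t t01; lra.
Qed.

Lemma le0_of_le_mull {R : realType} (a c : R) :
  (forall t : R, 0 < t < 1 -> a <= t * c) -> a <= 0.
Proof.
move=> small; rewrite leNgt; apply/negP => a0.
pose t := Num.min (2^-1) (a / (2 * (`|c| + 1))).
have c1 : 0 < `|c| + 1 by rewrite ltr_wpDl.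
have t0 : 0 < t by rewrite lt_min invr_gt0 ltr0n/= divr_gt0// mulr_gt0.
have t1 : t < 1 by rewrite gt_min invf_lt1// ltr1n.
have := small t; rewrite t0 t1 => /(_ isT).
have tc : t * (2 * (`|c| + 1)) <= a.
  by rewrite -ler_pdivlMr ?mulr_gt0// ge_min lexx orbT.
have := ler_wpM2l (ltW t0) (ler_norm c).
by move: tc; rewrite mulrCA mulrDr mulr1; set p := t * `|c|; lra.
Qed.

Section extended_real_functions.
Context {R : realType} {V : hilbertType R}.
Implicit Types (f g : V -> \bar R) (u v w x y z : V).

Lemma proper_fin f x : Defs.proper f -> dom f x -> f x = (fine (f x))%:E.
Proof. by move=> [fN _] fx; rewrite fineK// fin_numE gt_eqF// lt_eqF. Qed.

Lemma econvex_fine f x y (t : R) : Defs.proper f -> econvex f ->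
  dom f x -> dom f y -> 0 < t < 1 ->
  dom f (t *: x + (1 - t) *: y) /\
  fine (f (t *: x + (1 - t) *: y)) <= t * fine (f x) + (1 - t) * fine (f y).
Proof.
move=> fp fc fx fy t01; have := fc x y t t01.
rewrite (proper_fin fp fx) (proper_fin fp fy) -!EFinM -EFinD => fle.
have ft : dom f (t *: x + (1 - t) *: y) by exact: le_lt_trans fle (ltry _).
by split=> //; move: fle; rewrite (proper_fin fp ft) lee_fin.
Qed.

Lemma econvex_segment f x s (t : R) : Defs.proper f -> econvex f ->
  dom f x -> dom f s -> 0 < t <= 1 ->
  dom f (x - t *: (x - s)) /\
  fine (f (x - t *: (x - s))) <= (1 - t) * fine (f x) + t * fine (f s).
Proof.
move=> fp fc fx fs /andP[t0]; rewrite le_eqVlt => /predU1P[->|t1].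
  by rewrite scale1r subKr subrr mul0r mul1r add0r.
rewrite (_ : x - _ = t *: s + (1 - t) *: x); last first.
  by rewrite scalerBr scalerBl scale1r opprB addrCA.
by rewrite [_ + t * _]addrC; apply: econvex_fine; rewrite ?t0.
Qed.

Lemma subdifferential_fin g v : Defs.proper g -> subdifferential g v !=set0 ->
  dom g v.
Proof.
move=> [gN [w gw]] [u /(_ w)]; rewrite /dom/= => le_gw.
rewrite ltey; apply/eqP => gv.
move: le_gw; rewrite gv addye// leye_eq => /eqP gw'.
by move: gw; rewrite /dom/= gw' ltxx.
Qed.

Lemma subdifferentialP g v (u : V) : Defs.proper g -> dom g v ->
  subdifferential g v u <->
  forall w, dom g w -> fine (g v) + inner u (w - v) <= fine (g w).
Proof.
move=> gp gv; split=> [gu w gw|gu w].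
  by have := gu w; rewrite (proper_fin gp gv) (proper_fin gp gw) lee_fin.
have [gw|] := pselect (dom g w).
  by rewrite (proper_fin gp gv) (proper_fin gp gw) lee_fin; exact: gu.
by rewrite /dom/= ltey => /negP; rewrite negbK => /eqP ->; rewrite leey.
Qed.

(** The subdifferential is an intersection of closed half-spaces, hence closed
    and convex, and so has a point of least norm. *)
Lemma min_norm_elementP g v : Defs.proper g -> subdifferential g v !=set0 ->
  subdifferential g v (min_norm_element (subdifferential g v)).
Proof.
move=> gp gv0; have gv := subdifferential_fin gp gv0.
rewrite /min_norm_element; case: xgetP => [u _ [] //|nomin].
have [||u u' gu gu'|u umin] := @exists_min_norm _ _ (subdifferential g v).
- exact: gv0.
- rewrite (_ : subdifferential g v = \bigcap_(w in dom g)
    ((inner (w - v) : V -> R^o) @^-1` [set r | r <= fine (g w) - fine (g v)])).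
    apply: closed_bigI => w gw; apply: closed_comp; last exact: closed_le.
    by move=> u _; exact: inner_continuous.
  apply/seteqP; split=> u.
    move=> /(subdifferentialP _ gp gv) gu w gw /=.
    by have := gu w gw; rewrite innerC; lra.
  move=> gu; apply/(subdifferentialP _ gp gv) => w gw.
  by have := gu w gw; rewrite /= innerC; lra.
- move: gu gu' => /(subdifferentialP _ gp gv) gu /(subdifferentialP _ gp gv) gu'.
  apply/(subdifferentialP _ gp gv) => w gw.
  by have := gu w gw; have := gu' w gw; rewrite innerZl innerDl; lra.
- by exfalso; exact: (nomin u umin).
Qed.

Lemma convex_gradient_le f x z : Defs.proper f -> econvex f ->
  dom f x -> dom f z -> differentiable (fine \o f : V -> R^o) x ->
  fine (f x) + inner (gradient f x) (z - x) <= fine (f z).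
Proof.
move=> fp fc fx fz df; rewrite -gradientP//.
apply: (@convex_diff_le _ _ (fine \o f : V -> R^o)) => // t t01 /=.
by have [] := econvex_fine fp fc fz fx t01.
Qed.

Section prox.
Context (g : V -> \bar R) (g_proper : Defs.proper g) (g_convex : econvex g).

Lemma prox_dom (beta : R) v y : argmin (prox_objective beta g v) y -> dom g y.
Proof.
move=> ymin; have [_ [w gw]] := g_proper; have := ymin w.
rewrite /prox_objective (proper_fin g_proper gw) -EFinD /dom/= => yw.
by have := le_lt_trans yw (ltry _); case: (g y) (g_proper.1 y).
Qed.

Lemma prox_le (beta : R) v y w : argmin (prox_objective beta g v) y ->
  dom g w ->
  fine (g y) + (2 * beta)^-1 * `|v - y| ^+ 2 <=
  fine (g w) + (2 * beta)^-1 * `|v - w| ^+ 2.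
Proof.
move=> ymin gw; have gy := prox_dom ymin; have := ymin w.
by rewrite /prox_objective (proper_fin g_proper gw) (proper_fin g_proper gy) lee_fin.
Qed.

(** Optimality condition of the proximal step: moving from y towards w changes
    the quadratic term to first order only through its gradient. *)
Lemma prox_subgradient (beta : R) v y w : 0 < beta ->
  argmin (prox_objective beta g v) y -> dom g w ->
  fine (g y) + beta^-1 * inner (v - y) (w - y) <= fine (g w).
Proof.
move=> beta0 ymin gw; have gy := prox_dom ymin.
rewrite -subr_le0.
apply: (@le0_of_le_mull _ _ ((2 * beta)^-1 * `|w - y| ^+ 2)) => t t01.
have [gt gtle] := econvex_fine g_proper g_convex gw gy t01.
have := prox_le ymin gt.
rewrite (_ : v - (t *: w + (1 - t) *: y) = (v - y) - t *: (w - y)); last first.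
  rewrite scalerBr scalerBl scale1r; set a := t *: w; set c := t *: y.
  by rewrite !opprD !opprK !addrA; congr (_ + _); rewrite addrAC.
rewrite (normB_sqr (v - y)) innerZr normZ_sqr invfM.
set p := inner _ _; set n := `|w - y| ^+ 2; set m := `|v - y| ^+ 2 => le_t.
have /andP[t0 t1] := t01.
rewrite -(@ler_pM2l _ t)// -subr_ge0.
move: gtle le_t; rewrite -subr_ge0 => gtle; rewrite -subr_ge0 => le_t.
apply: le_trans (addr_ge0 gtle le_t) _; rewrite le_eqVlt; apply/orP; left.
by apply/eqP; field; rewrite gt_eqF.
Qed.

(** The Moreau envelope of g at v' is at least its first-order expansion at v;
    stated for the function that is minimized over w to define the envelope. *)
Lemma prox_joint_le (beta : R) v y v' w : 0 < beta ->
  argmin (prox_objective beta g v) y -> dom g w ->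
  fine (g y) + (2 * beta)^-1 * `|v - y| ^+ 2 + beta^-1 * inner (v - y) (v' - v)
    <= fine (g w) + (2 * beta)^-1 * `|v' - w| ^+ 2.
Proof.
move=> beta0 ymin gw; have := prox_subgradient beta0 ymin gw.
have -> : v' - v = (v' - w) + (w - y) - (v - y).
  by rewrite opprB !addrA !subrK.
move: (v - y) (v' - w) (w - y) => p q e.
have := sqr_ge0 `|q - p|; rewrite normB_sqr invfM => sq.
rewrite innerBr innerDr inner_norm [inner p q]innerC.
move: sq; set a := inner q p; set m := `|p| ^+ 2; set n := `|q| ^+ 2 => sq.
have i0 : 0 <= beta^-1 by rewrite invr_ge0 ltW.
by have := mulr_ge0 i0 sq; nra.
Qed.

(** Decreasing the smoothing parameter raises the Moreau envelope by at most
    half the decrease times the squared norm of a subgradient. The competitor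
    for the new proximal problem contracts w towards v by the factor
    beta' / beta, for which the two quadratic terms scale alike. *)
Lemma prox_value_change (beta beta' M : R) v y w u : 0 < beta' <= beta ->
  argmin (prox_objective beta' g v) y -> dom g w ->
  dom g v -> subdifferential g v u -> `|u| <= M ->
  fine (g y) + (2 * beta')^-1 * `|v - y| ^+ 2 <=
  fine (g w) + (2 * beta)^-1 * `|v - w| ^+ 2 + (beta - beta') * (M ^+ 2 / 2).
Proof.
move=> /andP[b'0 b'b] ymin gw gv gu uM; have b0 := lt_le_trans b'0 b'b.
pose t := beta' / beta.
have t01 : 0 < t <= 1 by rewrite divr_gt0//= ler_pdivrMr// mul1r.
have [gt gtle] := econvex_segment g_proper g_convex gv gw t01.
have yle := prox_le ymin gt; rewrite subKr normZ_sqr in yle.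
have gwle := (subdifferentialP _ g_proper gv).1 gu w gw.
rewrite -[w - v]opprB innerNr [inner u _]innerC in gwle.
have sq := sqr_ge0 `|(v - w) - beta *: u|.
rewrite (normB_sqr (v - w)) normZ_sqr innerZr in sq.
have mM : `|u| ^+ 2 <= M ^+ 2 by rewrite ler_pXn2r// nnegrE// (le_trans _ uM).
move: gtle mM sq gwle yle; set p := inner _ _; set n := `|v - w| ^+ 2; set m := `|u| ^+ 2.
set X := _ + (2 * beta)^-1 * _; move=> gtle mM sq gwle yle.
have quad : (2 * beta')^-1 * (t ^+ 2 * n) = t * ((2 * beta)^-1 * n).
  by rewrite /t; field; rewrite !gt_eqF.
rewrite quad in yle.
have gX : fine (g v) - X <= beta * (M ^+ 2 / 2).
  rewrite /X; apply: (@le_trans _ _ (p - (2 * beta)^-1 * n)); first by lra.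
  apply: (@le_trans _ _ (beta * (m / 2))); last by rewrite ler_pM2l// ler_pM2r.
  rewrite -subr_ge0.
  have -> : beta * (m / 2) - (p - (2 * beta)^-1 * n) =
      (2 * beta)^-1 * (n - 2 * (beta * p) + beta ^+ 2 * m).
    by field; rewrite gt_eqF.
  by rewrite mulr_ge0// invr_ge0 mulr_ge0// ltW.
have /andP[t0 t1] := t01.
have := ler_wpM2l (_ : 0 <= 1 - t) gX; rewrite subr_ge0 => /(_ t1).
have tb : (1 - t) * beta = beta - beta' by rewrite /t mulrBl mul1r divfK// gt_eqF.
rewrite [X in _ <= X]mulrA tb.
rewrite mulrBr => gX'; apply: le_trans yle _.
have : t * X = t * fine (g w) + t * ((2 * beta)^-1 * n) by rewrite -mulrDr.
move: gX' gtle; rewrite mulrBl mul1r mulrBl mul1r.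
set a := t * X; set e := t * fine (g v); set e' := t * fine (g w).
set q := t * (_ * _); set r := _ * (M ^+ 2 / 2).
by clearbody a e e' q r X; lra.
Qed.

End prox.

Lemma convex_sub_gradient_le (phi psi : V -> R^o) x z u v :
  differentiable phi x -> differentiable psi x ->
  (forall w, 'd phi x w = inner u w) -> (forall w, 'd psi x w = inner v w) ->
  (forall t : R, 0 < t < 1 ->
     phi (t *: z + (1 - t) *: x) - psi (t *: z + (1 - t) *: x) <=
     t * (phi z - psi z) + (1 - t) * (phi x - psi x)) ->
  phi x - psi x + (inner u (z - x) - inner v (z - x)) <= phi z - psi z.
Proof.
move=> dphi dpsi phiu psiv conv; rewrite -phiu -psiv.
apply: le_trans (@convex_diff_le _ _ (phi - psi) x z _ conv); last first.
  exact: differentiableB.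
rewrite lerD2l le_eqVlt; apply/orP; left; apply/eqP/esym.
exact: (congr1 (fun k : V -> R^o => k (z - x)) (diffB dphi dpsi)).
Qed.

(** The (F, zeta)-smooth substitute for the descent lemma: since F - f is convex,
    the Bregman divergence of f is at most that of F, which the smoothness
    constant compares with zeta. *)
Lemma FZ_smooth_descent (F f h : V -> \bar R) (zeta : R -> R) :
  Defs.proper h -> econvex h ->
  (forall t, 0 < t <= 1 -> 0 <= zeta t) -> FZ_smooth F zeta f (dom h) ->
  exists2 K : R, 0 <= K &
    forall x s (t : R), dom h x -> dom h s -> 0 < t <= 1 ->
      fine (f (x - t *: (x - s))) <=
      fine (f x) + t * inner (gradient f x) (s - x) + K * zeta t.
Proof.
move=> hp hc zeta0 [_ [C0 [_ [CC0 _] [dF df] conv Kfin]]].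
set S := smoothness_constant _ _ _ in Kfin.
(* S may be -oo, whence the maximum *)
exists (Num.max 0 (fine S)); first by rewrite le_max lexx.
move=> x s t hx hs t01; have /andP[t0 t1] := t01.
set z := x - _.
have zE : z = x + t *: (s - x) by rewrite /z -scalerN opprB.
have zx : z - x = t *: (s - x) by rewrite zE addrC addKr.
have hz : dom h z by have [] := econvex_segment hp hc hx hs t01.
have Sle : (S <= (Num.max 0 (fine S))%:E)%E.
  by move: Kfin; case: S => [r _||] //=; rewrite ?leNye// lee_fin le_max lexx orbT.
have DF : bregman F z x <= Num.max 0 (fine S) * zeta t.
  have : ((bregman F z x)%:E / (zeta t)%:E <= (Num.max 0 (fine S))%:E)%E.
    apply: le_trans Sle; apply: ereal_sup_ubound; exists x, s, t.
    by rewrite -zE.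
  have := zeta0 t t01; rewrite le_eqVlt => /predU1P[<-|zt0].
    rewrite inve0 mulr0; have [//|D0] := leP (bregman F z x) 0.
    by rewrite gt0_muley ?lte_fin// leye_eq.
  by rewrite inver gt_eqF// -EFinM lee_fin ler_pdivrMr.
have [_ dFx] := dF x (CC0 _ hx); have [_ dfx] := df x (CC0 _ hx).
have convF := @convex_sub_gradient_le (fine \o F) (fine \o f) x z _ _ dFx dfx
  (fun v => gradientP v dFx) (fun v => gradientP v dfx).
have lin : inner (gradient f x) (z - x) = t * inner (gradient f x) (s - x).
  by rewrite zx innerZr.
rewrite -lin.
have gap (Fx fx Fz fz p q k : R) : Fx - fx + (p - q) <= Fz - fz ->
  Fz - Fx - p <= k -> fz <= fx + q + k.
  by clear; lra.
apply: (gap _ _ _ _ _ _ _ _ DF); apply: convF => r r01.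
apply: conv => //; apply: CC0 => //.
by have [] := econvex_fine hp hc hz hx r01.
Qed.

End extended_real_functions.

(** * Real sequences with bounded partial sums *)

Section bounded_sums.
Context {R : realType}.
Implicit Types (u v w e gamma : nat -> R).

(** For nonnegative terms this is convergence of the series; bounds on partial
    sums can be combined without taking limits. *)
Definition bounded_sums u := exists S, forall n, \sum_(0 <= k < n) u k <= S.

Lemma bounded_sumsD u v : bounded_sums u -> bounded_sums v ->
  bounded_sums (fun k => u k + v k).
Proof.
by move=> [S uS] [S' vS]; exists (S + S') => n; rewrite big_split lerD.
Qed.

Lemma bounded_sumsZ (c : R) u : 0 <= c -> bounded_sums u ->
  bounded_sums (fun k => c * u k).
Proof.
by move=> c0 [S uS]; exists (c * S) => n; rewrite -mulr_sumr ler_wpM2l.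
Qed.

Lemma bounded_sums_le u v : (forall k, u k <= v k) -> bounded_sums v ->
  bounded_sums u.
Proof.
by move=> uv [S vS]; exists S => n; apply: le_trans (vS n); exact: ler_sum.
Qed.

Lemma bounded_sums_of_succ u : bounded_sums (fun k => u k.+1) -> bounded_sums u.
Proof.
move=> [S uS]; exists (`|u 0%N| + Num.max 0 S) => -[|n].
  by rewrite big_nil addr_ge0// le_max lexx.
by rewrite big_nat_recl//= lerD ?ler_norm// le_max uS orbT.
Qed.

Lemma bounded_sums_succ u : bounded_sums u -> bounded_sums (fun k => u k.+1).
Proof.
move=> [S uS]; exists (S - u 0%N) => n.
by have := uS n.+1; rewrite big_nat_recl//= lerBrDl.
Qed.

Lemma bounded_sums_telescope u (l : R) : (forall k, l <= u k) ->
  bounded_sums (fun k => u k - u k.+1).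
Proof.
move=> lu; exists (u 0%N - l) => n.
suff -> : \sum_(0 <= k < n) (u k - u k.+1) = u 0%N - u n by rewrite lerD2l lerN2.
rewrite -[RHS]opprB -(telescope_sumr u)// -sumrN.
by apply: eq_bigr => k _; rewrite opprB.
Qed.

Lemma sum_nondecreasing u : (forall k, 0 <= u k) ->
  {homo (fun n => \sum_(0 <= k < n) u k) : m n / (m <= n)%N >-> m <= n}.
Proof.
move=> u0 m n mn; rewrite (big_cat_nat (leq0n m) mn)//= lerDl.
by apply: sumr_ge0.
Qed.

Lemma cvg_series_bounded_sums u : (forall k, 0 <= u k) ->
  cvgn (series u) <-> bounded_sums u.
Proof.
move=> u0; have ndu := sum_nondecreasing u0; split=> [cu|[S uS]].
  by exists (limn (series u)) => n; exact: (nondecreasing_cvgn_le ndu cu n).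
apply: nondecreasing_is_cvgn; first exact: ndu.
by exists S => _ [n _ <-]; exact: uS.
Qed.

Lemma not_cvg_series_unbounded u (M : R) : (forall k, 0 <= u k) ->
  ~ cvgn (series u) -> exists n, M < \sum_(0 <= k < n) u k.
Proof.
move=> u0; apply: contra_notP => noM; apply/(cvg_series_bounded_sums u0).
by exists M => n; rewrite leNgt; apply/negP => ?; apply: noM; exists n.
Qed.

Lemma bounded_sums_tail u (eps : R) : 0 < eps -> bounded_sums u ->
  exists N, forall n, (N <= n)%N -> \sum_(N <= k < n) u k <= eps.
Proof.
move=> eps0 [S uS].
pose E := [set \sum_(0 <= k < n) u k | n in [set: nat]].
have supE : has_sup E.
  split; first by exists (\sum_(0 <= k < 0) u k), 0%N.
  by exists S => _ [n _ <-].
have [_ [N _ <-] supN] := sup_adherent eps0 supE.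
exists N => n Nn; have : \sum_(0 <= k < n) u k <= sup E.
  by apply: ub_le_sup; [exact: supE.2|exists n].
by rewrite (big_cat_nat (leq0n N) Nn)//= => le_sup; move: le_sup supN; lra.
Qed.

Lemma lyapunov_bounded_sums (U s e : nat -> R) (B : R) :
  (forall k, U k.+1 <= U k - s k + e k) -> (forall k, - B <= U k) ->
  bounded_sums e -> bounded_sums s.
Proof.
move=> decr lbU [S eS]; exists (U 0%N + B + S) => n.
have : U n <= U 0%N - \sum_(0 <= k < n) s k + \sum_(0 <= k < n) e k.
  elim: n => [|n IH]; first by rewrite !big_nil subr0 addr0.
  by rewrite !big_nat_recr//=; have := decr n; lra.
by have := lbU n; have := eS n; lra.
Qed.

Lemma bounded_sums_sqr (gamma beta : nat -> R) : (forall k, 0 < beta k) ->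
  (forall k, beta k.+1 <= beta k) ->
  bounded_sums (fun k => gamma k ^+ 2 / beta k) ->
  bounded_sums (fun k => gamma k ^+ 2).
Proof.
move=> beta0 beta_noninc g2b.
apply: (@bounded_sums_le _ (fun k => beta 0%N * (gamma k ^+ 2 / beta k))).
  move=> k; rewrite mulrCA ler_peMr ?sqr_ge0// ler_pdivlMr// mul1r.
  elim: k => // k; exact: le_trans.
by apply: bounded_sumsZ => //; exact: ltW.
Qed.

Section divergent_weights.
Context (gamma : nat -> R) (gamma_gt0 : forall k, 0 < gamma k)
  (gamma_diverges : ~ cvgn (series gamma)).

Let gamma_ge0 k : 0 <= gamma k. Proof. exact: ltW. Qed.

Lemma partial_sum_gt0 k : 0 < partial_sum gamma k.
Proof.
rewrite /partial_sum big_nat_recr//= ltr_wpDl//.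
by apply: sumr_ge0.
Qed.

Lemma weighted_sum_small u N (delta : R) : 0 < delta ->
  bounded_sums (fun k => gamma k * u k) ->
  exists2 m, (N <= m)%N & u m <= delta.
Proof.
move=> delta0 gu; apply: contrapT => nosmall; apply: gamma_diverges.
apply/(cvg_series_bounded_sums gamma_ge0).
have big_u m : (N <= m)%N -> delta < u m.
  by move=> Nm; rewrite ltNge; apply/negP => um; apply: nosmall; exists m.
have [M gM] := gu.
exists (\sum_(0 <= k < N) gamma k +
        delta^-1 * (M - \sum_(0 <= k < N) gamma k * u k)) => n.
have [nN|Nn] := leqP n N.
  apply: le_trans (sum_nondecreasing gamma_ge0 nN) _.
  by rewrite lerDl mulr_ge0 ?invr_ge0 ?(ltW delta0)// subr_ge0.
rewrite (big_cat_nat (leq0n N) (ltnW Nn))//= lerD2l ler_pdivlMl// mulr_sumr.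
have := gM n; rewrite (big_cat_nat (leq0n N) (ltnW Nn))//= -lerBrDl; apply: le_trans.
rewrite big_nat_cond [leRHS]big_nat_cond; apply: ler_sum => k.
by rewrite andbT => /andP[Nk _]; rewrite mulrC ler_pM2l// ltW// big_u.
Qed.

(** A weighted-summable sequence is small infinitely often; the quasi-monotone
    recursion for the squares carries smallness over to all later terms. *)
Lemma quasi_monotone_cvg0 u e : (forall k, 0 <= u k) -> (forall k, 0 <= e k) ->
  (forall k, u k.+1 ^+ 2 <= u k ^+ 2 + e k) -> bounded_sums e ->
  bounded_sums (fun k => gamma k * u k) -> u @ \oo --> 0.
Proof.
move=> u0 e0 uS es gu; apply/cvgr0Pnorm_le => eps eps0.
have h0 : 0 < eps ^+ 2 / 2 by rewrite divr_gt0// exprn_gt0.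
have [N eN] := bounded_sums_tail h0 es.
have e2 : 0 < eps / 2 by rewrite divr_gt0.
have [m Nm um] := weighted_sum_small N e2 gu.
have step n : (m <= n)%N -> u n ^+ 2 <= u m ^+ 2 + \sum_(m <= k < n) e k.
  move=> /subnK <-; elim: (n - m)%N => [|p IH].
    by rewrite add0n big_geq// addr0.
  rewrite addSn big_nat_recr ?leq_addl//= addrA; apply: le_trans (uS _) _.
  by rewrite lerD2r.
exists m => // n /= mn; rewrite ger0_norm//.
rewrite -(@ler_pXn2r _ 2)// ?nnegrE ?(ltW eps0)//.
apply: le_trans (step n mn) _.
have um2 : u m ^+ 2 <= (eps / 2) ^+ 2.
  by rewrite ler_pXn2r// nnegrE// ltW.
have tail_le : \sum_(m <= k < n) e k <= \sum_(N <= k < n) e k.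
  by rewrite (big_cat_nat Nm mn)//= lerDr sumr_ge0.
have := eN n (leq_trans Nm mn).
rewrite exprMn exprVn in um2; move: um2 tail_le h0.
by rewrite (_ : 2 ^+ 2 = 4 :> R) ?expr2//; lra.
Qed.

(** Abel-Dini: the series of the gamma_k / Gamma_k diverges as well, because a
    block of it over which Gamma doubles contributes at least 1/2. *)
Lemma frequently_le_inv_partial_sum u N : (forall k, 0 <= u k) ->
  bounded_sums (fun k => gamma k * u k) ->
  exists2 k, (N <= k)%N & u k <= (partial_sum gamma k)^-1.
Proof.
move=> u0 gu; apply: contrapT => never.
have u_gt k : (N <= k)%N -> (partial_sum gamma k)^-1 < u k.
  by move=> Nk; rewrite ltNge; apply/negP => uk; apply: never; exists k.
have q0 : 0 < 4^-1 :> R by rewrite invr_gt0.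
have [N' tail] := bounded_sums_tail q0 gu.
pose m := maxn N N'.
have [n Mn] := not_cvg_series_unbounded (2 * \sum_(0 <= k < m) gamma k + 1)
  gamma_ge0 gamma_diverges.
have G0 : 0 <= \sum_(0 <= k < m) gamma k by apply: sumr_ge0.
have mn : (m < n)%N.
  rewrite ltnNge; apply/negP => nm.
  by have := sum_nondecreasing gamma_ge0 nm; move: Mn G0; lra.
pose G := \sum_(0 <= k < n) gamma k.
have Gn0 : 0 < G by move: Mn G0; rewrite -/G; lra.
have half : G^-1 * \sum_(m <= k < n) gamma k <= \sum_(m <= k < n) gamma k * u k.
  rewrite mulr_sumr big_nat_cond [leRHS]big_nat_cond; apply: ler_sum => k.
  rewrite andbT => /andP[mk kn]; rewrite mulrC ler_pM2l//.
  apply: le_trans (ltW (u_gt k (leq_trans (leq_maxl _ _) mk))).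
  rewrite lef_pV2 ?posrE ?partial_sum_gt0//.
  exact: sum_nondecreasing.
have : \sum_(m <= k < n) gamma k * u k <= 4^-1.
  apply: le_trans (tail n (leq_trans (leq_maxr N N') (ltnW mn))).
  rewrite (big_cat_nat (leq_maxr N N') (ltnW mn))//= lerDr.
  by apply: sumr_ge0 => k _; rewrite mulr_ge0.
move=> /(le_trans half); rewrite mulrC ler_pdivrMr//.
move: Mn; rewrite -/G {1 2}/G (big_cat_nat (leq0n m) (ltnW mn))//=.
by move: G0; set a := \sum_(0 <= k < m) _; set b := \sum_(m <= k < n) _; lra.
Qed.

(** Jensen's inequality for the squared norm. *)
Lemma norm_weighted_sum_le (W : normedModType R) (a : nat -> W) n :
  `|\sum_(0 <= k < n) gamma k *: a k| ^+ 2 <=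
  (\sum_(0 <= k < n) gamma k) * \sum_(0 <= k < n) gamma k * `|a k| ^+ 2.
Proof.
case: n => [|n]; first by rewrite !big_nil normr0 expr0n/= mul0r.
pose t := \sum_(0 <= k < n.+1) gamma k * `|a k|.
have t0 : 0 <= t by apply: sumr_ge0 => k _; rewrite mulr_ge0.
apply: (@le_trans _ _ (t ^+ 2)).
  rewrite ler_pXn2r ?nnegrE//; apply: le_trans (ler_norm_sum _ _ _) _.
  by apply: ler_sum => k _; rewrite normrZ gtr0_norm.
have := partial_sum_gt0 n; rewrite /partial_sum.
set G := \sum_(0 <= k < _) gamma k; set Q := \sum_(0 <= k < _) _ => G0.
(* the weighted variance of the norms about their mean t / G *)
have : 0 <= \sum_(0 <= k < n.+1) gamma k * (`|a k| - t / G) ^+ 2.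
  by apply: sumr_ge0 => k _; rewrite mulr_ge0// sqr_ge0.
have -> : \sum_(0 <= k < n.+1) gamma k * (`|a k| - t / G) ^+ 2 =
    Q - 2 * (t / G) * t + (t / G) ^+ 2 * G.
  rewrite /Q /t /G !mulr_sumr -!sumrN -!big_split/=.
  by apply: eq_bigr => k _; ring.
have -> : Q - 2 * (t / G) * t + (t / G) ^+ 2 * G = (G * Q - t ^+ 2) / G.
  by field; rewrite gt_eqF.
by rewrite pmulr_lge0 ?invr_gt0// subr_ge0.
Qed.

End divergent_weights.
End bounded_sums.

(** * One step of the algorithm *)

Section one_step.
Context {R : realType} {Hp Hd Hv : hilbertType R}.
Context (f : Hp -> \bar R) (g : Hv -> \bar R) (h : Hp -> \bar R).
Context (T : {linear Hp -> Hv}) (A : {linear Hp -> Hd}) (b : Hd).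

(** The variable w is left free instead of being minimized out, which would
    give the Moreau envelope of g at T u: an iterate is paired with its proximal
    point y, and the dual value is the infimum over u and w together. *)
Definition smoothed_lagrangian (beta rho : R) (u : Hp) (w : Hv) (mu : Hd) : R :=
  fine (f u) + fine (h u) + (fine (g w) + (2 * beta)^-1 * `|T u - w| ^+ 2)
  + inner mu (A u - b) + rho / 2 * `|A u - b| ^+ 2.

Local Notation L := smoothed_lagrangian.

Lemma inexact_oracle_le (z s shat : Hp) (err : R) :
  Defs.proper h ->
  argmin (fun u => h u + (inner z u)%:E)%E s ->
  (h shat + (inner z shat)%:E <= h s + (inner z s)%:E + err%:E)%E ->
  dom h shat /\ forall u, dom h u ->
    fine (h shat) + inner z shat <= fine (h u) + inner z u + err.
Proof.
move=> hp smin shatle.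
have le_u u : dom h u ->
    (h shat + (inner z shat)%:E <= (fine (h u) + inner z u + err)%:E)%E.
  move=> hu; apply: le_trans shatle _.
  by rewrite EFinD leeD2r// EFinD -(proper_fin hp hu).
have [_ [u0 hu0]] := hp.
have hshat : dom h shat.
  have := le_lt_trans (le_u u0 hu0) (ltry _).
  by rewrite /dom/=; case: (h shat) (hp.1 shat).
by split=> // u /le_u; rewrite (proper_fin hp hshat) lee_fin.
Qed.

Context (f_ccp : closed_convex_proper f) (g_ccp : closed_convex_proper g)
  (h_ccp : closed_convex_proper h).
Context (T_bounded : continuous T) (A_bounded : continuous A).
Context (dom_sub : dom h `<=` dom f)
  (f_diff : forall x, dom h x -> differentiable (fine \o f : Hp -> R^o) x).

(** The linearizations at x of f, of the smoothed g and of the augmentation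
    minorize these functions, and their sum with h is what the oracle minimizes
    up to the errors. The augmentation being quadratic, its linearization falls
    short of it by exactly rho / 2 |A u - A x|^2, which is the gain in this
    estimate. *)
Lemma conditional_gradient_step (beta rho gamma Kzeta : R) (x : Hp) (y : Hv)
    (mu : Hd) (z shat lam : Hp) (err : R) (u : Hp) (w : Hv) :
  0 < beta -> 0 < gamma <= 1 ->
  dom h x -> dom h shat -> dom h u -> dom g w ->
  argmin (prox_objective beta g (T x)) y ->
  z = gradient f x + beta^-1 *: adjoint T (T x - y) + adjoint A mu
      + rho *: adjoint A (A x - b) + lam ->
  fine (h shat) + inner z shat <= fine (h u) + inner z u + err ->
  fine (f (x - gamma *: (x - shat))) <=
    fine (f x) + gamma * inner (gradient f x) (shat - x) + Kzeta ->
  L beta rho (x - gamma *: (x - shat)) y mu <=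
  L beta rho x y mu
  + gamma * (L beta rho u w mu - L beta rho x y mu - rho / 2 * `|A u - A x| ^+ 2)
  + (Kzeta + gamma ^+ 2 / 2 * (beta^-1 * `|T (shat - x)| ^+ 2
                               + rho * `|A (shat - x)| ^+ 2)
     + gamma * (err + inner lam (u - shat))).
Proof.
move=> beta0 gamma01 hx hs hu gw ymin zE oracle fdescent.
have [[fp fc _] [gp gc _]] := (f_ccp, g_ccp); have [hp hc _] := h_ccp.
have /andP[gamma0 gamma1] := gamma01.
have [_ hdescent] := econvex_segment hp hc hx hs gamma01.
have flin := convex_gradient_le fp fc (dom_sub hx) (dom_sub hu) (f_diff hx).
have glin := prox_joint_le gp gc (T u) beta0 ymin gw.
have xE : x - gamma *: (x - shat) = x + gamma *: (shat - x).
  by rewrite -scalerN opprB.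
have split_z v : inner z v = inner z x + (inner (gradient f x) (v - x)
    + beta^-1 * inner (T x - y) (T (v - x)) + inner mu (A (v - x))
    + rho * inner (A x - b) (A (v - x)) + inner lam (v - x)).
  have -> : inner z v = inner z x + inner z (v - x).
    by rewrite innerBr addrC subrK.
  congr (_ + _).
  rewrite zE !innerDl !innerZl.
  by rewrite (adjointP _ _ T_bounded) !(adjointP _ _ A_bounded) !innerDl.
rewrite (split_z shat) (split_z u) in oracle.
have Tx' : `|T (x + gamma *: (shat - x)) - y| ^+ 2 =
    `|T x - y| ^+ 2 + 2 * (gamma * inner (T x - y) (T (shat - x)))
    + gamma ^+ 2 * `|T (shat - x)| ^+ 2.
  rewrite [T (_ + _)]linearD [T (_ *: _)]linearZ/= addrAC.
  by rewrite (normD_sqr (T x - y)) innerZr normZ_sqr.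
have Ax' : A (x + gamma *: (shat - x)) - b = (A x - b) + gamma *: A (shat - x).
  by rewrite [A (_ + _)]linearD [A (_ *: _)]linearZ/= addrAC.
have Ax'2 : `|A (x + gamma *: (shat - x)) - b| ^+ 2 =
    `|A x - b| ^+ 2 + 2 * (gamma * inner (A x - b) (A (shat - x)))
    + gamma ^+ 2 * `|A (shat - x)| ^+ 2.
  by rewrite Ax' (normD_sqr (A x - b)) innerZr normZ_sqr.
have muAx' : inner mu (A (x + gamma *: (shat - x)) - b) =
    inner mu (A x - b) + gamma * inner mu (A (shat - x)).
  by rewrite Ax' innerDr innerZr.
have Au : A u - b = (A x - b) + A (u - x) 
  by rewrite linearB addrAC [A x + _]addrC subrK.
have Au2 : `|A u - b| ^+ 2 =
    `|A x - b| ^+ 2 + 2 * inner (A x - b) (A (u - x)) + `|A (u - x)| ^+ 2.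
  by rewrite Au normD_sqr.
have muAu : inner mu (A u - b) = inner mu (A x - b) + inner mu (A (u - x)).
  by rewrite Au innerDr.
have lamE : inner lam (u - shat) = inner lam (u - x) - inner lam (shat - x).
  by rewrite -innerBr opprB addrA subrK.
rewrite xE in fdescent hdescent *.
rewrite /smoothed_lagrangian Tx' Ax'2 muAx' Au2 muAu lamE -linearB.
rewrite -[T u - T x]linearB in glin.
have c2 : (2 * beta)^-1 = beta^-1 / 2 by rewrite invfM mulrC.
rewrite c2 in glin *.
move: fdescent hdescent flin glin oracle; clear -gamma0 beta0.
move: (fine (f (_ + _))) (fine (h (_ + _))) => f' h'.
set fx := fine (f x); set fu := fine (f u); set hx := fine (h x).
set hu := fine (h u); set hs := fine (h shat); set gy := fine (g y).
set gw := fine (g w); set q1 := inner (gradient f x) (shat - x).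
set q2 := inner (gradient f x) (u - x); set N0 := `|T x - y| ^+ 2.
set N1 := `|T (shat - x)| ^+ 2; set Nu := `|T u - w| ^+ 2.
set t1 := inner (T x - y) (T (shat - x)); set t2 := inner (T x - y) (T (u - x)).
set a0 := `|A x - b| ^+ 2; set a1 := inner (A x - b) (A (shat - x)).
set a2 := inner (A x - b) (A (u - x)); set n1 := `|A (shat - x)| ^+ 2.
set n2 := `|A (u - x)| ^+ 2; set m0 := inner mu (A x - b).
set m1 := inner mu (A (shat - x)); set m2 := inner mu (A (u - x)).
set l1 := inner lam (shat - x); set l2 := inner lam (u - x).
set zx := inner z x.
rewrite -subr_ge0 => H1; rewrite -subr_ge0 => H2; rewrite -subr_ge0 => H3.
rewrite -subr_ge0 => H4; rewrite -subr_ge0 => H5.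
have H := addr_ge0 (addr_ge0 H1 H2)
  (mulr_ge0 (ltW gamma0) (addr_ge0 (addr_ge0 H3 H4) H5)).
rewrite -subr_ge0; apply: le_trans H _; rewrite le_eqVlt; apply/orP; left.
by apply/eqP; field; rewrite gt_eqF.
Qed.

End one_step.

(** * Weighted summability of the infeasibility along a trajectory *)

Section trajectory.
Context {R : realType} {Hp Hd Hv : hilbertType R}.
Context (f : Hp -> \bar R) (g : Hv -> \bar R) (h : Hp -> \bar R).
Context (T : {linear Hp -> Hv}) (A : {linear Hp -> Hd}) (b : Hd).
Context (f_ccp : closed_convex_proper f) (g_ccp : closed_convex_proper g)
  (h_ccp : closed_convex_proper h).
Context (T_bounded : continuous T) (A_bounded : continuous A).
Context (dom_sub : dom h `<=` dom f)
  (f_diff : forall x, dom h x -> differentiable (fine \o f : Hp -> R^o) x).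
Context (zeta : R -> R) (K : R) (K_ge0 : 0 <= K)
  (descent : forall x s (t : R), dom h x -> dom h s -> 0 < t <= 1 ->
     fine (f (x - t *: (x - s))) <=
     fine (f x) + t * inner (gradient f x) (s - x) + K * zeta t).
Context (r : R) (C_bound : forall v, dom h v -> `|v| <= r).
Context (M : R) (subgradient_bound : forall x, dom h x ->
  dom g (T x) /\ exists2 u, subdifferential g (T x) u & `|u| <= M).
Context (xfeas : Hp) (dom_xfeas : dom h xfeas) (A_xfeas : A xfeas = b).
Context (gamma beta theta rho : nat -> R)
  (beta_gt0 : forall k, 0 < beta k) (gamma01 : forall k, 0 < gamma k <= 1)
  (zeta_sum : bounded_sums (fun k => zeta (gamma k)))
  (gamma2_beta_sum : bounded_sums (fun k => gamma k ^+ 2 / beta k))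
  (gamma_beta_sum : bounded_sums (fun k => gamma k * beta k))
  (beta_nonincreasing : forall k, beta k.+1 <= beta k)
  (rho_inf rho_sup : R) (rho_nondecreasing : forall k, rho k <= rho k.+1)
  (rho_inf_gt0 : 0 < rho_inf) (rho_bounds : forall k, rho_inf <= rho k <= rho_sup)
  (M_inf M_sup : R) (M_inf_gt0 : 0 < M_inf) (M_sup_gt0 : 0 < M_sup)
  (gamma_ratio : forall k, M_inf <= gamma k / gamma k.+1 <= M_sup)
  (c : R) (c_gt0 : 0 < c) (theta_def : forall k, theta k = gamma k / c)
  (c_large : M_sup / c - rho_inf / 2 < 0).
Context (lam : nat -> Hp) (lams : nat -> R)
  (x : nat -> Hp) (mu : nat -> Hd) (y : nat -> Hv) (z s shat : nat -> Hp)
  (traj : icgalp f g h T A b gamma beta theta rho lam lams x mu y z s shat)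
  (lam_sum : bounded_sums (fun k => gamma k * `|lam k|))
  (lams_sum : bounded_sums (fun k => gamma k * lams k)).

Let gamma_gt0 k : 0 < gamma k. Proof. by have /andP[] := gamma01 k. Qed.

Let gamma_le1 k : gamma k <= 1. Proof. by have /andP[] := gamma01 k. Qed.

Let f_proper : Defs.proper f. Proof. by case: f_ccp. Qed.
Let g_proper : Defs.proper g. Proof. by case: g_ccp. Qed.
Let h_proper : Defs.proper h. Proof. by case: h_ccp. Qed.

Local Notation L k := (smoothed_lagrangian f g h T A b (beta k) (rho k)).
Local Notation P k := (L k (x k) (y k) (mu k)).

Lemma oracle_le k : dom h (shat k) /\ forall u, dom h u ->
  fine (h (shat k)) + inner (z k) (shat k)
    <= fine (h u) + inner (z k) u + lams k.
Proof.
exact: inexact_oracle_le h_proper (icgalp_s traj k) (icgalp_shat traj k).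
Qed.

Lemma iterates_dom k : dom h (x k).
Proof.
elim: k => [|k IH]; first exact: icgalp_x0 traj.
rewrite (icgalp_x traj); have [_ hc _] := h_ccp; have [hs _] := oracle_le k.
by have [] := econvex_segment h_proper hc IH hs (gamma01 k).
Qed.

Lemma dist_le u v : dom h u -> dom h v -> `|u - v| <= 2 * r.
Proof.
move=> hu hv; apply: le_trans (ler_normB _ _) _.
by rewrite mulr2n mulrDl mul1r lerD// C_bound.
Qed.

Lemma linear_image_bound (V : hilbertType R) (B : {linear Hp -> V}) :
  continuous B -> exists2 Q : R, 0 <= Q &
    forall u v, dom h u -> dom h v -> `|B (u - v)| <= Q.
Proof.
move=> /continuous_linear_bound[Q Q0 BQ].
have r0 : 0 <= r by exact: le_trans (C_bound dom_xfeas).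
exists (Q * (2 * r)); first by rewrite !mulr_ge0// ltW.
move=> u v hu hv; apply: le_trans (BQ _) _.
by rewrite ler_wpM2l ?dist_le// ltW.
Qed.

(** Since dom h is bounded, the curvature of the smoothed g costs a multiple of
    gamma_k^2 / beta_k at step k, that of the augmentation a multiple of
    gamma_k^2, and the oracle one of gamma_k times its errors. *)
Lemma decrease_along_trajectory : exists e : nat -> R, bounded_sums e /\
  forall k u w, dom h u -> dom g w ->
    L k (x k.+1) (y k) (mu k) <=
    P k + gamma k * (L k u w (mu k) - P k - rho k / 2 * `|A u - A (x k)| ^+ 2)
    + e k.
Proof.
have [QT QT0 TQ] := linear_image_bound T_bounded.
have [QA QA0 AQ] := linear_image_bound A_bounded.
have r0 : 0 <= r by exact: le_trans (C_bound dom_xfeas).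
have rho0 k : 0 <= rho k.
  by have /andP[+ _] := rho_bounds k; apply: le_trans; exact: ltW.
have gamma2_sum := bounded_sums_sqr beta_gt0 beta_nonincreasing gamma2_beta_sum.
exists (fun k => K * zeta (gamma k)
  + (QT ^+ 2 / 2 * (gamma k ^+ 2 / beta k)
     + rho_sup * QA ^+ 2 / 2 * gamma k ^+ 2)
  + (gamma k * lams k + 2 * r * (gamma k * `|lam k|))).
split.
  have rs0 : 0 <= rho_sup.
    by have /andP[_] := rho_bounds 0; apply: le_trans.
  repeat apply: bounded_sumsD => //; apply: bounded_sumsZ => //.
  - by rewrite divr_ge0// sqr_ge0.
  - by rewrite divr_ge0// mulr_ge0// sqr_ge0.
  - by rewrite mulr_ge0.
move=> k u w hu gw; have hx := iterates_dom k.
have [hs oracle] := oracle_le k.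
have := conditional_gradient_step f_ccp g_ccp h_ccp T_bounded A_bounded dom_sub
  f_diff (beta_gt0 k) (gamma01 k) hx hs hu gw (icgalp_y traj k)
  (icgalp_z traj k) (oracle u hu) (descent hx hs (gamma01 k)).
rewrite -(icgalp_x traj) => /le_trans; apply; rewrite lerD2l.
have T2 : `|T (shat k - x k)| ^+ 2 <= QT ^+ 2.
  by rewrite ler_pXn2r ?nnegrE// TQ.
have A2 : `|A (shat k - x k)| ^+ 2 <= QA ^+ 2.
  by rewrite ler_pXn2r ?nnegrE// AQ.
apply: lerD; [apply: lerD => //|].
  have g2 : 0 <= gamma k ^+ 2 / 2 by rewrite divr_ge0// sqr_ge0.
  rewrite (_ : QT ^+ 2 / 2 * _ + _ =
    gamma k ^+ 2 / 2 * ((beta k)^-1 * QT ^+ 2 + rho_sup * QA ^+ 2)).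
    apply: ler_wpM2l => //; apply: lerD.
      by apply: ler_wpM2l => //; rewrite invr_ge0 ltW.
    apply: ler_pM => //.
    by have /andP[] := rho_bounds k.
  by field; rewrite gt_eqF.
rewrite [2 * r * _]mulrCA -mulrDr ler_pM2l// lerD2l.
apply: le_trans (ler_inner _ _) _; rewrite mulrC ler_wpM2r//.
exact: dist_le.
Qed.

(** The smoothing, the weight of the augmentation and the multiplier change from
    the k-th Lagrangian to the next one; each contributes one term. *)
Lemma lagrangian_update k :
  P k.+1 <= L k (x k.+1) (y k) (mu k) + (beta k - beta k.+1) * (M ^+ 2 / 2)
    + (rho k.+1 - rho k) / 2 * `|A (x k.+1) - b| ^+ 2
    + theta k * `|A (x k.+1) - b| ^+ 2.
Proof.
have [gTx [u gu uM]] := subgradient_bound (iterates_dom k.+1).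
have bb : 0 < beta k.+1 <= beta k by rewrite beta_gt0 beta_nonincreasing.
have [_ gc _] := g_ccp.
have gy := prox_dom g_proper (icgalp_y traj k).
have := prox_value_change g_proper gc bb (icgalp_y traj k.+1) gy gTx gu uM.
rewrite /smoothed_lagrangian (icgalp_mu traj) innerDl innerZl inner_norm.
move: (fine (f _)) (fine (h _)) (_ + (2 * beta k.+1)^-1 * _) => f' h' g1.
move: (_ + (2 * beta k)^-1 * _) ((beta k - _) * _) => g2 db.
move: (inner _ _) (`|_ - b| ^+ 2) (rho k) (rho k.+1) (theta k) => m a r0 r1 t.
by lra.
Qed.

Lemma lagrangian_le_succ k u w nu : L k u w nu <= L k.+1 u w nu.
Proof.
rewrite /smoothed_lagrangian; apply: lerD; last first.
  by rewrite ler_wpM2r ?sqr_ge0// ler_pM2r// rho_nondecreasing.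
rewrite lerD2r !lerD2l ler_wpM2r ?sqr_ge0//.
by rewrite lef_pV2 ?posrE ?mulr_gt0// ler_pM2l.
Qed.

Lemma lagrangian_dual_update k u w nu (v : Hd) (t : R) :
  L k u w (nu + t *: v) = L k u w nu + t * inner v (A u - b).
Proof.
by rewrite /smoothed_lagrangian innerDl innerZl; ring.
Qed.

(** The Lyapunov function is the sum of the primal gap P_k - D_k and of the dual
    gap - D_k, where D_k is the infimum of the k-th Lagrangian at mu_k; it is
    bounded below because D_k is at most the value at a feasible point. With
    a_k = A x_k - b and r_k the residual of an almost-minimizer of that
    Lagrangian, a step lowers it by gamma_k rho_k / 2 |a_k - r_k|^2, while the
    multiplier update adds theta_k (|a|^2 - 2 <a, r>) = theta_k (|a - r|^2 -
    |r|^2), with a and r taken at k + 1. The condition on c lets the gain of the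
    next step absorb theta_k |a - r|^2; what remains controls |a - r| and |r|,
    hence |a|. *)
Theorem infeasibility_bounded_sums :
  bounded_sums (fun k => gamma k * `|A (x k) - b| ^+ 2).
Proof.
have [e [e_sum step]] := decrease_along_trajectory.
have [QA QA0 AQ] := linear_image_bound A_bounded.
pose S k := [set L k p.1 p.2 (mu k) | p in [set p | dom h p.1 /\ dom g p.2]].
pose D k := inf (S k).
(* The one-step estimate, solved for the value at (u, w), is a lower bound. *)
have lbS k : has_lbound (S k).
  exists ((L k (x k.+1) (y k) (mu k) - P k - e k) / gamma k + P k).
  move=> _ [[u w] [/= hu gw] <-]; rewrite -lerBrDr ler_pdivrMr// mulrC.
  have := step k u w hu gw.
  have : 0 <= gamma k * (rho k / 2 * `|A u - A (x k)| ^+ 2).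
    have /andP[rk _] := rho_bounds k.
    rewrite !mulr_ge0 ?sqr_ge0 ?invr_ge0 ?(ltW (gamma_gt0 k))//.
    by rewrite (le_trans _ rk)// ltW.
  rewrite [gamma k * (_ - _ - _)]mulrBr.
  move: (e k) (P k) (L k (x k.+1) _ _) (gamma k * (_ - _)) (gamma k * (rho k / 2 * _)).
  by move=> ? ? ? ? ?; lra.
have D_le k u w : dom h u -> dom g w -> D k <= L k u w (mu k).
  by move=> hu gw; apply: ge_inf => //; exists (u, w).
have gTx k : dom g (y k) := prox_dom g_proper (icgalp_y traj k).
(* gamma_k beta_k serves as a positive summable tolerance *)
have minimizers k : exists p : Hp * Hv,
    [/\ dom h p.1, dom g p.2 & L k p.1 p.2 (mu k) <= D k + gamma k * beta k].
  have eps0 : 0 < gamma k * beta k by rewrite mulr_gt0.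
  have [|_ [p [hp gp] <-] pD] := @inf_adherent _ (S k) _ eps0.
    split=> //; exists (P k), (x k, y k) => //; split => //=.
    exact: iterates_dom.
  by exists p; split=> //; exact: ltW.
have [p pP] := choice minimizers.
pose a k := A (x k) - b; pose q k := A (p k).1 - b.
pose dd k := `|a k - q k| ^+ 2.
have [gTf _] := subgradient_bound dom_xfeas.
have aQ u : dom h u -> `|A u - b| <= QA.
  by move=> hu; rewrite -A_xfeas -linearB AQ.
have aQ2 k : `|a k| ^+ 2 <= QA ^+ 2.
  by rewrite ler_pXn2r ?nnegrE// aQ//; exact: iterates_dom.
have ddQ k : dd k <= QA ^+ 2.
  have [hp _ _] := pP k.
  rewrite /dd /a /q opprB addrA subrK -linearB ler_pXn2r ?nnegrE// AQ//.
  exact: iterates_dom.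
pose Dstar := fine (f xfeas) + fine (h xfeas) + fine (g (T xfeas)).
have D_Dstar k : D k <= Dstar.
  apply: le_trans (D_le k _ _ dom_xfeas gTf) _.
  rewrite /smoothed_lagrangian A_xfeas !subrr !normr0 inner0r expr0n/=.
  by rewrite !mulr0 !addr0.
have D_P k : D k <= P k by apply: D_le => //; exact: iterates_dom.
pose kappa := M_sup / c; have kappa0 : 0 <= kappa by rewrite divr_ge0 ?ltW.
pose delta := rho_inf / 2 - kappa.
have delta0 : 0 < delta by rewrite /delta subr_gt0 -subr_lt0.
have theta_le k : theta k <= kappa * gamma k.+1.
  rewrite theta_def /kappa mulrAC ler_pM2r ?invr_gt0//.
  by have /andP[_] := gamma_ratio k; rewrite ler_pdivrMr.
have theta_ge k : M_inf / c * gamma k.+1 <= theta k.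
  rewrite theta_def mulrAC ler_pM2r ?invr_gt0//.
  by have /andP[+ _] := gamma_ratio k; rewrite ler_pdivlMr.
have theta0 k : 0 <= theta k by rewrite theta_def divr_ge0 ?ltW.
have dual_step k : D k <= D k.+1 + gamma k.+1 * beta k.+1
    - theta k * inner (a k.+1) (q k.+1).
  have [hp gp pD] := pP k.+1.
  apply: le_trans (D_le k _ _ hp gp) _; rewrite lerBrDr.
  apply: le_trans pD; rewrite (icgalp_mu traj) lagrangian_dual_update lerD2r.
  exact: lagrangian_le_succ.
(* The last term is the reserve that pays for the term in theta at k - 1. *)
pose U k := P k - 2 * D k - kappa * (gamma k * dd k).
pose sk k := delta * (gamma k * dd k) + theta k * `|q k.+1| ^+ 2.
pose err k := gamma k * beta k + e k + M ^+ 2 / 2 * (beta k - beta k.+1)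
  + QA ^+ 2 / 2 * (rho k.+1 - rho k) + 2 * (gamma k.+1 * beta k.+1).
have sk_sum : bounded_sums sk.
  apply: (@lyapunov_bounded_sums _ U _ err (Dstar + kappa * QA ^+ 2)).
  - move=> k; have [hp gp pD] := pP k.
    have H1 := step k _ _ hp gp; have H2 := lagrangian_update k.
    have H3 := dual_step k.
    have H4 : gamma k * (L k (p k).1 (p k).2 (mu k) - P k) <= gamma k * beta k.
      apply: (@le_trans _ _ (gamma k * (gamma k * beta k))).
        rewrite ler_pM2l// lerBlDr; apply: le_trans pD _.
        by rewrite addrC lerD2l.
      by rewrite ler_piMl// mulr_ge0// ltW.
    have H5 : rho_inf / 2 * (gamma k * dd k) <=
        gamma k * (rho k / 2 * `|A (p k).1 - A (x k)| ^+ 2).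
      rewrite /dd /a /q opprB addrA subrK distrC mulrCA ler_pM2l//.
      rewrite ler_wpM2r ?sqr_ge0// ler_pM2r//.
      by have /andP[] := rho_bounds k.
    have H6 : (rho k.+1 - rho k) / 2 * `|a k.+1| ^+ 2 <=
        QA ^+ 2 / 2 * (rho k.+1 - rho k).
      rewrite mulrAC [leRHS]mulrAC ler_pM2r// mulrC ler_wpM2r//.
      by rewrite subr_ge0.
    have H7 : theta k * dd k.+1 <= kappa * (gamma k.+1 * dd k.+1).
      by rewrite mulrA ler_wpM2r// sqr_ge0.
    have H8 : theta k * dd k.+1 = theta k * `|a k.+1| ^+ 2 -
        2 * (theta k * inner (a k.+1) (q k.+1)) + theta k * `|q k.+1| ^+ 2.
      by rewrite /dd normB_sqr; ring.
    rewrite mulrBr in H1; rewrite -/(a _) in H2.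
    rewrite /U /sk /err /delta.
    move: H1 H2 H3 H4 H5 H6 H7 H8.
    move: (P k.+1) (P k) (L k (x k.+1) _ _) (gamma k * (L k _ _ _ - _)) => P1 P0 L1 L2.
    move: (gamma k * (rho k / 2 * _)) (theta k * dd k.+1) (kappa * (gamma k.+1 * _)).
    move=> G1 t1 t2.
    move: (theta k * inner _ _) (theta k * `|q _| ^+ 2) (theta k * `|a _| ^+ 2).
    move=> t3 t4 t5; move: ((rho k.+1 - _) / 2 * _) (QA ^+ 2 / 2 * _) => r1 r2.
    move: (D k) (D k.+1) (gamma k.+1 * beta _) (gamma k * beta k) (e k) => D0 D1 e1 e2 e3.
    rewrite [(_ - _) * (M ^+ 2 / 2)]mulrC.
    rewrite (mulrBl (gamma k * dd k)).
    move: (M ^+ 2 / 2 * _) (rho_inf / 2 * _) (kappa * (gamma k * _)) => m1 k1 k2.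
    by lra.
  - move=> k; rewrite /U.
    have H : kappa * (gamma k * dd k) <= kappa * QA ^+ 2.
      by rewrite ler_wpM2l//; apply: le_trans (ddQ k); rewrite ler_piMl ?sqr_ge0.
    have := D_P k; have := D_Dstar k; move: H.
    move: (kappa * _) (kappa * _) (D k) (P k) => k1 k2 D0 P0.
    by lra.
  - repeat apply: bounded_sumsD => //.
    + apply: bounded_sumsZ; first by rewrite divr_ge0// sqr_ge0.
      by apply: (@bounded_sums_telescope _ _ 0) => k; exact: ltW.
    + apply: bounded_sumsZ; first by rewrite divr_ge0// sqr_ge0.
      have := @bounded_sums_telescope _ (fun k => - rho k) (- rho_sup).
      have -> : (fun k => rho k.+1 - rho k) = (fun k => - rho k - - rho k.+1).
        by apply/funext => k; rewrite opprK addrC.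
      by apply=> k; rewrite lerN2; have /andP[] := rho_bounds k.
    + apply: bounded_sumsZ => //.
      exact: (bounded_sums_succ gamma_beta_sum).
have dd_sum : bounded_sums (fun k => gamma k * dd k).
  apply: (@bounded_sums_le _ _ (fun k => delta^-1 * sk k)); last first.
    by apply: bounded_sumsZ => //; rewrite invr_ge0 ltW.
  move=> k; rewrite ler_pdivlMl// lerDl mulr_ge0// sqr_ge0.
have q_sum : bounded_sums (fun k => gamma k * `|q k| ^+ 2).
  apply: bounded_sums_of_succ.
  apply: (@bounded_sums_le _ _ (fun k => (M_inf / c)^-1 * sk k)); last first.
    by apply: bounded_sumsZ => //; rewrite invr_ge0 divr_ge0 ?ltW.
  move=> k; rewrite ler_pdivlMl ?divr_gt0// mulrA.
  apply: (@le_trans _ _ (theta k * `|q k.+1| ^+ 2)).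
    by rewrite ler_wpM2r// sqr_ge0.
  rewrite lerDr; apply: mulr_ge0; first exact: ltW.
  by apply: mulr_ge0; [exact: ltW|exact: sqr_ge0].
apply: (@bounded_sums_le _ _
  (fun k => 2 * (gamma k * dd k) + 2 * (gamma k * `|q k| ^+ 2))); last first.
  by apply: bounded_sumsD; exact: bounded_sumsZ.
move=> k; rewrite -mulrDr -mulrDr [leRHS]mulrCA ler_pM2l//.
have -> : A (x k) - b = (a k - q k) + q k by rewrite subrK.
have := sqr_ge0 `|(a k - q k) - q k|.
rewrite (normB_sqr (a k - q k)) (normD_sqr (a k - q k)) /dd.
by move: (`|a k - q k| ^+ 2) (inner _ _) (`|q k| ^+ 2) => ? ? ?; lra.
Qed.

Lemma infeasibility_increment : exists2 Q : R, 0 <= Q & forall k,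
  `|A (x k.+1) - b| ^+ 2 <= `|A (x k) - b| ^+ 2 + Q * gamma k.
Proof.
have [QA QA0 AQ] := linear_image_bound A_bounded.
exists (3 * QA ^+ 2); first by rewrite mulr_ge0// sqr_ge0.
move=> k; have [hs _] := oracle_le k; have hx := iterates_dom k.
have incr : `|A (x k.+1) - b| <= `|A (x k) - b| + QA * gamma k.
  rewrite (icgalp_x traj) linearB linearZ/= addrAC.
  apply: le_trans (ler_normB _ _) _; rewrite lerD2l normrZ gtr0_norm// mulrC.
  by rewrite ler_pM2r// AQ.
have aQ : `|A (x k) - b| <= QA by rewrite -A_xfeas -linearB AQ.
rewrite -(@ler_pXn2r _ 2) ?nnegrE ?addr_ge0 ?mulr_ge0 ?(ltW (gamma_gt0 k))// in incr.
apply: le_trans incr _; rewrite sqrrD -addrA lerD2l exprMn.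
have g2 : gamma k ^+ 2 <= gamma k by rewrite expr2 ler_piMl// ltW.
have := ler_wpM2r (mulr_ge0 QA0 (ltW (gamma_gt0 k))) aQ.
have := ler_wpM2l (sqr_ge0 QA) g2.
rewrite [QA * (QA * _)]mulrA -expr2 mulr2n -[3 * _ * _]mulrA.
by move: (`|_| * _) (QA ^+ 2 * gamma k) (QA ^+ 2 * gamma k ^+ 2) => p m q; lra.
Qed.

End trajectory.

(** * Rates of convergence from weighted summability *)

Section rates.
Context {R : realType} {V : hilbertType R}.
Context (gamma : nat -> R) (gamma_gt0 : forall k, 0 < gamma k)
  (gamma_diverges : ~ cvgn (series gamma)).
Context (a : nat -> V)
  (a_sum : bounded_sums (fun k => gamma k * `|a k| ^+ 2)).

Let Gamma_gt0 := partial_sum_gt0 gamma_gt0.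

(** The squared residuals u_k increase by O(gamma_k), hence their squares by
    O(gamma_k u_k + gamma_k^2), which is summable. *)
Lemma residual_cvg0 (Q : R) : 0 <= Q -> bounded_sums (fun k => gamma k ^+ 2) ->
  (forall k, `|a k.+1| ^+ 2 <= `|a k| ^+ 2 + Q * gamma k) ->
  (fun k => `|a k|) @ \oo --> 0.
Proof.
move=> Q0 g2 incr.
pose e k := 2 * Q * (gamma k * `|a k| ^+ 2) + Q ^+ 2 * gamma k ^+ 2.
have e0 k : 0 <= e k.
  by rewrite addr_ge0// !mulr_ge0 ?sqr_ge0// ltW.
have e_sum : bounded_sums e.
  by apply: bounded_sumsD; apply: bounded_sumsZ => //; rewrite ?sqr_ge0 ?mulr_ge0.
have a2 : (fun k => `|a k| ^+ 2) @ \oo --> 0.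
  apply: (@quasi_monotone_cvg0 _ _ gamma_gt0 gamma_diverges _ e) => // k.
  apply: (@le_trans _ _ ((`|a k| ^+ 2 + Q * gamma k) ^+ 2)).
    by rewrite ler_pXn2r ?nnegrE ?addr_ge0 ?sqr_ge0 ?mulr_ge0 ?(ltW (gamma_gt0 _)).
  by rewrite /e le_eqVlt; apply/orP; left; apply/eqP; ring.
apply/cvgr0Pnorm_le => eps eps0.
have eps2 : 0 < eps ^+ 2 by rewrite exprn_gt0.
move/cvgr0Pnorm_le: a2 => /(_ _ eps2); apply: filterS => k.
by rewrite ger0_norm ?sqr_ge0// normr_id ler_pXn2r ?nnegrE// ltW.
Qed.

Lemma frequently_small_residual : exists phi : nat -> nat,
  (forall j, (phi j < phi j.+1)%N) /\
  forall j, `|a (phi j)| <= (Num.sqrt (partial_sum gamma (phi j)))^-1.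
Proof.
have pick N : exists k, (N <= k)%N /\ `|a k| <= (Num.sqrt (partial_sum gamma k))^-1.
  have [k Nk ak] := frequently_le_inv_partial_sum gamma_gt0 gamma_diverges N
    (fun k => sqr_ge0 `|a k|) a_sum.
  exists k; split=> //; rewrite -(@ler_pXn2r _ 2)// ?nnegrE ?invr_ge0 ?sqrtr_ge0//.
  by rewrite exprVn sqr_sqrtr// ltW.
have [next nextP] := choice pick.
pose fix phi j := if j is i.+1 then next (phi i).+1 else next 0%N.
exists phi; split=> [j|[|j]]; first exact: (nextP _).1.
  exact: (nextP _).2.
exact: (nextP _).2.
Qed.

Lemma bigO_inv_sqrt_partial_sum (v : nat -> R) (S : R) :
  (forall k, 0 <= v k) -> (forall k, v k ^+ 2 * partial_sum gamma k <= S) ->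
  (v : nat -> R^o)
    =O_\oo (fun k => (Num.sqrt (partial_sum gamma k))^-1 : R^o).
Proof.
move=> v0 vS; apply/eqOP; near=> c; apply: nearW => k.
have sG : 0 < Num.sqrt (partial_sum gamma k) by rewrite sqrtr_gt0.
rewrite !ger0_norm ?invr_ge0 ?(ltW sG)// ler_pdivlMr//.
apply: (@le_trans _ _ (Num.sqrt S)); last by near: c; exact: nbhs_pinfty_ge.
have -> : v k * Num.sqrt (partial_sum gamma k) =
    Num.sqrt (v k ^+ 2 * partial_sum gamma k).
  by rewrite sqrtrM ?sqr_ge0// sqrtr_sqr ger0_norm.
by rewrite ler_wsqrtr.
Unshelve. all: by end_near. Qed.

Lemma inf_residual_rate :
  (fun k => inf [set `|a i| | i in `I_k.+1] : R^o)
    =O_\oo (fun k => (Num.sqrt (partial_sum gamma k))^-1 : R^o).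
Proof.
have [S aS] := a_sum.
have inf0 k : 0 <= inf [set `|a i| | i in `I_k.+1].
  by apply: lb_le_inf => [|_ [i _ <-]//]; exists `|a 0%N|, 0%N.
apply: (@bigO_inv_sqrt_partial_sum _ S) => // k.
apply: le_trans (aS k.+1); rewrite /partial_sum mulr_sumr.
rewrite big_nat_cond [leRHS]big_nat_cond; apply: ler_sum => i.
rewrite andbT => /andP[_ ik]; rewrite mulrC ler_pM2l//.
rewrite ler_pXn2r ?nnegrE//; apply: ge_inf; last by exists i.
by exists 0 => _ [j _ <-].
Qed.

Lemma mean_residual_rate :
  (fun k => `|(partial_sum gamma k)^-1 *: \sum_(0 <= i < k.+1) gamma i *: a i| : R^o)
    =O_\oo (fun k => (Num.sqrt (partial_sum gamma k))^-1 : R^o).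
Proof.
have [S aS] := a_sum.
apply: (@bigO_inv_sqrt_partial_sum _ S) => // k.
apply: le_trans (aS k.+1); rewrite normrZ exprMn real_normK ?num_real//.
have := norm_weighted_sum_le gamma_gt0 a k.+1; have := Gamma_gt0 k.
rewrite -/(partial_sum gamma k); set G := partial_sum _ _ => G0 jensen.
rewrite -(ler_pM2l G0); apply: le_trans jensen; rewrite le_eqVlt.
by apply/orP; left; apply/eqP; field; rewrite gt_eqF.
Qed.

End rates.

Lemma ergodic_mean_residual {R : realType} {V W : hilbertType R}
    (A : {linear V -> W}) (b : W) (gamma : nat -> R) (x : nat -> V) k :
  (forall i, 0 < gamma i) ->
  A (ergodic_mean gamma x k) - b =
  (partial_sum gamma k)^-1 *: \sum_(0 <= i < k.+1) gamma i *: (A (x i) - b).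
Proof.
move=> gamma0; rewrite /ergodic_mean linearZ/= linear_sum/=.
under [in RHS]eq_bigr do rewrite scalerBr.
rewrite sumrB -scaler_suml scalerBr scalerA mulVf ?scale1r; last first.
  by rewrite gt_eqF// partial_sum_gt0.
by under eq_bigr do rewrite linearZ.
Qed.

(** * Conditional expectations of nonnegative errors *)

Section conditional_summability.
Context {R : realType} {d : measure_display} {Omega : measurableType d}.
Context (P : probability Omega R).
Context (G : nat -> set (set Omega)) (G_measurable : forall k, G k `<=` measurable)
  (G_nondecreasing : forall i k, (i <= k)%N -> G i `<=` G k).

Lemma generated_measurable k (B : set Omega) : <<s G k >> B -> measurable B.
Proof.
apply: smallest_sub; last exact: G_measurable.
exact: sigma_algebra_measurable.
Qed.

Lemma measurable_wrt_fun k (Y : Omega -> R) : measurable_wrt (G k) Y ->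
  measurable_fun [set: Omega] Y.
Proof.
move=> mY _ B mB; apply: (@generated_measurable k).
exact: (mY measurableT B mB).
Qed.

Lemma measurable_wrt_mono i k (Y : Omega -> R) : (i <= k)%N ->
  measurable_wrt (G i) Y -> measurable_wrt (G k) Y.
Proof.
move=> ik mY _ B mB.
exact: (sub_sigma_algebra2 (G_nondecreasing ik) (mY measurableT B mB)).
Qed.

Lemma bounded_sums_of_nneseries (u : nat -> R) : (forall k, 0 <= u k) ->
  (\sum_(k <oo) (u k)%:E)%E \is a fin_num -> bounded_sums u.
Proof.
move=> u0 ufin; exists (fine (\sum_(k <oo) (u k)%:E)%E) => n.
rewrite -lee_fin fineK// -sumEFin; apply: nneseries_lim_ge => k _ _.
by rewrite lee_fin.
Qed.

Lemma stopped_sum_le (u : nat -> R) (n : nat) m : (forall k, 0 <= u k) ->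
  \sum_(0 <= k < m) (if \sum_(0 <= i < k.+1) u i <= n%:R then u k else 0) <= n%:R.
Proof.
move=> u0; elim: m => [|m IH]; first by rewrite big_nil.
rewrite big_nat_recr//=; case: ifPn => [le_n|_]; last by rewrite addr0.
apply: le_trans le_n; rewrite [leRHS]big_nat_recr//= lerD2r.
by apply: ler_sum => k _; case: ifP.
Qed.

(** A conditional form of the Borel-Cantelli lemma. On the event B_k that the
    conditional expectations up to k sum to at most n, which is known at time k,
    the integrals of X_k and of its conditional expectation agree; hence the sum
    of the c_k X_k stopped when B_k fails has expectation at most n. Almost
    every point lies in all the B_k for some n. *)
Lemma conditional_summable (c : nat -> R) (X : nat -> Omega -> R) :
  (forall k, 0 <= c k) -> (forall k w, 0 <= X k w) ->
  (forall k, measurable_fun [set: Omega] (X k)) ->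
  summable_cond_expectation P G c X ->
  {ae P, forall w, bounded_sums (fun k => c k * X k w)}.
Proof.
move=> c0 X0 mX [e [eP [ceP ce_cvg]]].
have ce0 k w : 0 <= c k * e k w by have [/(_ w)] := ceP k.
pose s k w := \sum_(0 <= i < k.+1) c i * e i w.
have ms k : measurable_wrt (G k) (s k).
  elim: k => [|k IH].
    rewrite (_ : s 0%N = (fun w => c 0%N * e 0%N w)); last first.
      by apply/funext => w; rewrite /s big_nat1.
    by have [_] := ceP 0%N.
  rewrite (_ : s k.+1 = s k \+ (fun w => c k.+1 * e k.+1 w)); last first.
    by apply/funext => w; rewrite /s big_nat_recr.
  apply: measurable_funD; first exact: (measurable_wrt_mono (leqnSn k) IH).
  by have [_] := ceP k.+1.
pose B n k := [set w | s k w <= n%:R].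
have GB n k : <<s G k >> (B n k).
  have -> : B n k = [set: Omega] `&` s k @^-1` [set` `]-oo, (n%:R : R)]].
    by rewrite setTI; apply/seteqP; split=> w; rewrite /B/= in_itv.
  exact: (ms k measurableT _ (measurable_itv _)).
have mB n k : measurable (B n k) := generated_measurable (GB n k).
have stop n : {ae P, forall w, bounded_sums (fun k =>
    if s k w <= n%:R then c k * X k w else 0)}.
  pose stopped (Y : nat -> Omega -> R) k :=
    (fun w => (c k * Y k w)%:E) \_ (B n k).
  have stoppedE (Y : nat -> Omega -> R) k w :
      stopped Y k w = (if s k w <= n%:R then c k * Y k w else 0)%:E.
    rewrite /stopped /patch; case: ifPn => [/set_mem|/negP].
      by rewrite /B/= => ->.
    by move=> nB; case: ifPn => // sn; exfalso; apply/nB/mem_set.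
  have stopped0 (Y : nat -> Omega -> R) : (forall k w, 0 <= Y k w) ->
      forall k w, (0 <= stopped Y k w)%E.
    by move=> Y0 k w; rewrite stoppedE lee_fin; case: ifP => // _; rewrite mulr_ge0.
  have mEFin (Y : Omega -> R) : measurable_fun [set: Omega] Y ->
      measurable_fun [set: Omega] (EFin \o Y) by move=> ?; exact/measurable_EFinP.
  have mstopped (Y : nat -> Omega -> R) k : measurable_fun [set: Omega] (Y k) ->
      measurable_fun [set: Omega] (stopped Y k).
    move=> mY; apply/(measurable_restrictT _ (mB n k)); apply: measurable_funTS.
    by apply: mEFin; apply: (measurable_funM (measurable_cst (c k)) mY).
  have int_stopped (Y : nat -> Omega -> R) k : (forall k w, 0 <= Y k w) ->
      measurable_fun [set: Omega] (Y k) ->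
      (\int[P]_w stopped Y k w = (c k)%:E * \int[P]_(w in B n k) (Y k w)%:E)%E.
    move=> Y0 mY; rewrite /stopped -integral_mkcond.
    rewrite -ge0_integralZl_EFin//; first by move=> w _; rewrite lee_fin.
    by apply: measurable_funTS; exact: mEFin.
  have e0 k w : 0 <= e k w by have [] := eP k.
  have me k : measurable_fun [set: Omega] (e k).
    by have [_ /measurable_wrt_fun] := eP k.
  have sum_le w : (\sum_(k <oo) stopped e k w <= n%:R%:E)%E.
    apply: lime_le; first by apply: is_cvg_nneseries => k _ _; exact: stopped0.
    apply: nearW => m; under eq_bigr do rewrite stoppedE.
    by rewrite sumEFin lee_fin (@stopped_sum_le (fun k => c k * e k w)).
  have int_sum : (\int[P]_w (\sum_(k <oo) stopped X k w) =
                 \int[P]_w (\sum_(k <oo) stopped e k w))%E.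
    rewrite !integral_nneseries//; try by move=> k w _; exact: stopped0.
    - apply: eq_eseriesr => k _; rewrite !int_stopped//.
      by have [_ _ ->//] := eP k; exact: GB.
    - by move=> k; exact: mstopped.
    - by move=> k; exact: mstopped.
  have msum (Y : nat -> Omega -> R) : (forall k w, 0 <= Y k w) ->
      (forall k, measurable_fun [set: Omega] (Y k)) ->
      measurable_fun [set: Omega] (fun w => \sum_(k <oo) stopped Y k w)%E.
    move=> Y0 mY; apply: ge0_emeasurable_sum => [k w _ _|k _]; first exact: stopped0.
    exact: mstopped.
  have : P.-integrable [set: Omega] (fun w => \sum_(k <oo) stopped X k w)%E.
    apply/integrableP; split; first exact: msum.
    under eq_integral => w _.
      rewrite gee0_abs; last by apply: nneseries_ge0 => k _ _; exact: stopped0.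
      over.
    rewrite int_sum; apply: (@le_lt_trans _ _ (\int[P]_w (cst n%:R%:E w))%E).
      apply: ge0_le_integral => //.
        by move=> w _; apply: nneseries_ge0 => k _ _; exact: stopped0.
      exact: msum.
    rewrite integral_cst//; apply: (@le_lt_trans _ _ (n%:R%:E * 1)%E).
      by apply: lee_wpmul2l; rewrite ?lee_fin// probability_le1.
    by rewrite mule1 ltry.
  move=> /(integrable_ae measurableT); apply: filterS => w /(_ I).
  under eq_eseriesr do rewrite stoppedE.
  apply: bounded_sums_of_nneseries => k.
  by case: ifP => // _; rewrite mulr_ge0.
have /ae_foralln all_stop := stop.
near=> w.
have stop_w : forall n, bounded_sums (fun k => if s k w <= n%:R then c k * X k w else 0).
  by near: w; exact: all_stop.
have [S eS] : bounded_sums (fun k => c k * e k w).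
  by apply/cvg_series_bounded_sums => //; near: w; exact: ce_cvg.
have [n Sn] : exists n : nat, S <= n%:R.
  exists (Num.bound `|S|); apply: le_trans (ler_norm _) _.
  exact/ltW/archi_boundP.
apply: bounded_sums_le (stop_w n) => k.
by rewrite (le_trans (eS k.+1) Sn).
Unshelve. all: by end_near. Qed.

End conditional_summability.

(** * Measurability of the history and of the errors *)

Section history.
Context {R : realType} {d : measure_display} {Omega : measurableType d}.

Lemma generated_by_measurable (V : hilbertType R) (X : Omega -> V) :
  measurable_fun [set: Omega] (X : Omega -> borel V) ->
  generated_by X `<=` measurable.
Proof. by move=> mX _ [B mB <-]; exact: mX. Qed.

Lemma history_measurable (V W : hilbertType R) (x0 : Omega -> V)
    (mu0 : Omega -> W) (shat : nat -> Omega -> V) k :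
  measurable_fun [set: Omega] (x0 : Omega -> borel V) ->
  measurable_fun [set: Omega] (mu0 : Omega -> borel W) ->
  (forall k, measurable_fun [set: Omega] (shat k : Omega -> borel V)) ->
  history x0 mu0 shat k `<=` measurable.
Proof.
move=> mx0 mmu0 mshat B [[]|[i _]]; exact: generated_by_measurable.
Qed.

Lemma history_nondecreasing (V W : hilbertType R) (x0 : Omega -> V)
    (mu0 : Omega -> W) (shat : nat -> Omega -> V) i k :
  (i <= k)%N -> history x0 mu0 shat i `<=` history x0 mu0 shat k.
Proof.
move=> ik B [B0|[j ji Bj]]; first by left.
by right; exists j => //=; exact: leq_trans ji _.
Qed.

Lemma norm_measurable (V : hilbertType R) (X : Omega -> V) :
  measurable_fun [set: Omega] (X : Omega -> borel V) ->
  measurable_fun [set: Omega] (fun w => `|X w|).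
Proof.
move=> mX.
have mN : measurable_fun [set: borel V] (fun v : borel V => `|v : V|).
  apply: (measurability _ (RGenOInfty.measurableE R)) => _ [_ [a ->] <-].
  rewrite setTI; apply: sub_sigma_algebra.
  rewrite (_ : _ @^-1` _ = (fun v : V => `|v|) @^-1` [set t | a < t]).
    by apply: open_comp; [move=> v _; exact: norm_continuous|exact: open_gt].
  by apply/seteqP; split=> v /=; rewrite in_itv/= andbT.
exact: (measurableT_comp mN mX).
Qed.

End history.

(** * Asymptotic feasibility *)

(** Varying the multiplier in the saddle-point inequality in the direction of
    the residual forces the latter to vanish. *)
Lemma saddle_point_feasible {R : realType} {Hp Hd Hv : hilbertType R}
    (f : Hp -> \bar R) (g : Hv -> \bar R) (h : Hp -> \bar R)
    (T : {linear Hp -> Hv}) (A : {linear Hp -> Hd}) (b : Hd)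
    (xs : Hp) (mus : Hd) :
  Defs.proper f -> Defs.proper g -> Defs.proper h ->
  (exists x, [/\ dom f x, dom g (T x) & dom h x]) ->
  saddle_point f g h T A b xs mus -> dom h xs /\ A xs = b.
Proof.
move=> fp gp hp [x [fx gx hx]] saddle.
have fin : (lagrangian f g h T A b xs mus < +oo)%E.
  apply: le_lt_trans (saddle x mus).2 _.
  by rewrite /lagrangian (proper_fin fp fx) (proper_fin gp gx) (proper_fin hp hx) ltry.
have [fxs gxs hxs] : [/\ dom f xs, dom g (T xs) & dom h xs].
  have := (fp.1 xs, gp.1 (T xs), hp.1 xs); move: fin.
  rewrite /lagrangian /dom/=.
  case: (f xs) => [?||] //; case: (g (T xs)) => [?||] //;
  case: (h xs) => [?||] // _ [[]] //.
split=> //; have := (saddle xs (mus + (A xs - b))).1.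
rewrite /lagrangian (proper_fin fp fxs) (proper_fin gp gxs) (proper_fin hp hxs).
rewrite -!EFinD lee_fin lerD2l innerDl gerDl inner_norm => res.
apply/eqP; rewrite -subr_eq0 -normr_eq0 -sqrf_eq0.
by rewrite eq_le res sqr_ge0.
Qed.

Theorem theorem4p7 (R : realType) (Hp Hd Hv : hilbertType R)
  (T : {linear Hp -> Hv}) (A : {linear Hp -> Hd}) (b : Hd)
  (f : Hp -> \bar R) (g : Hv -> \bar R) (h : Hp -> \bar R)
  (F : Hp -> \bar R) (zeta : R -> R)
  (T_bounded : continuous T) (A_bounded : continuous A)
  (b_ran : range A b)
  (g_ccp : closed_convex_proper g)
  (* (A.1) *)
  (f_ccp : closed_convex_proper f)
  (gT_ccp : closed_convex_proper (g \o T))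
  (h_ccp : closed_convex_proper h)
  (* (A.2) *)
  (F_gt_ninfty : forall x, (-oo < F x)%E)
  (zeta_ge0 : forall t, 0 < t <= 1 -> 0 <= zeta t)
  (f_smooth : FZ_smooth F zeta f (dom h))
  (* (A.3) *)
  (C_weakly_compact : weakly_compact (dom h))
  (* (A.4) *)
  (TC_dom_subdiff : forall x, dom h x -> subdifferential g (T x) !=set0)
  (subdiff_bounded :
     (ereal_sup [set `|min_norm_element (subdifferential g (T x))|%:E
                | x in dom h] < +oo)%E)
  (* (A.6) *)
  (has_saddle_point : exists xs mus, saddle_point f g h T A b xs mus)
  (gamma beta theta rho : nat -> R)
  (beta_gt0 : forall k, 0 < beta k)
  (* (P.1) *)
  (gamma01 : forall k, 0 < gamma k <= 1)
  (zeta_gamma_ell1 : ell1_plus (fun k => zeta (gamma k)))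
  (gamma2_beta_ell1 : ell1_plus (fun k => gamma k ^+ 2 / beta k))
  (gamma_beta_ell1 : ell1_plus (fun k => gamma k * beta k))
  (* (P.2) *)
  (gamma_not_ell1 : ~ cvgn (series gamma))
  (* (P.3) *)
  (beta_nonincreasing : forall k, beta k.+1 <= beta k)
  (beta_cvg0 : beta @ \oo --> (0 : R))
  (* (P.4) *)
  (rho_inf rho_sup : R)
  (rho_nondecreasing : forall k, rho k <= rho k.+1)
  (rho_inf_gt0 : 0 < rho_inf)
  (rho_bounds : forall k, rho_inf <= rho k <= rho_sup)
  (* (P.5) *)
  (M_inf M_sup : R)
  (M_inf_gt0 : 0 < M_inf) (M_sup_gt0 : 0 < M_sup)
  (gamma_ratio : forall k, M_inf <= gamma k / gamma k.+1 <= M_sup)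
  (* (P.6) *)
  (c : R) (c_gt0 : 0 < c)
  (theta_def : forall k, theta k = gamma k / c)
  (c_large : M_sup / c - rho_inf / 2 < 0)
  (d : measure_display) (Omega : measurableType d) (P : probability Omega R)
  (lam : nat -> Omega -> Hp) (lams : nat -> Omega -> R)
  (x : nat -> Omega -> Hp) (mu : nat -> Omega -> Hd) (y : nat -> Omega -> Hv)
  (z s shat : nat -> Omega -> Hp)
  (lam_measurable :
     forall k, measurable_fun [set: Omega] (lam k : Omega -> borel Hp))
  (lams_measurable : forall k, measurable_fun [set: Omega] (lams k))
  (lams_ge0 : forall k w, 0 <= lams k w)
  (x0_measurable : measurable_fun [set: Omega] (x 0%N : Omega -> borel Hp))
  (mu0_measurable : measurable_fun [set: Omega] (mu 0%N : Omega -> borel Hd))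
  (shat_measurable :
     forall k, measurable_fun [set: Omega] (shat k : Omega -> borel Hp))
  (x_icgalp : forall w,
     icgalp f g h T A b gamma beta theta rho (lam ^~ w) (lams ^~ w)
       (x ^~ w) (mu ^~ w) (y ^~ w) (z ^~ w) (s ^~ w) (shat ^~ w))
  (* (P.8) *)
  (lam_summable :
     summable_cond_expectation P (history (x 0%N) (mu 0%N) shat)
       (fun k => gamma k.+1) (fun k w => `|lam k.+1 w|))
  (lams_summable :
     summable_cond_expectation P (history (x 0%N) (mu 0%N) shat)
       (fun k => gamma k.+1) (fun k w => lams k.+1 w)) :
  (* (i) *)
  {ae P, forall w, (fun k => `|A (x k w) - b|) @ \oo --> (0 : R)} /\
  (* (ii) *)
  ({ae P, forall w,
     (fun k => inf [set `|A (x i w) - b| | i in `I_k.+1] : R^o)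
     =O_\oo (fun k => (Num.sqrt (partial_sum gamma k))^-1 : R^o)} /\
   {ae P, forall w, exists phi : nat -> nat,
     (forall j, (phi j < phi j.+1)%N) /\
     forall j, `|A (x (phi j) w) - b|
                 <= (Num.sqrt (partial_sum gamma (phi j)))^-1}) /\
  (* (iii) *)
  {ae P, forall w,
     (fun k => `|A (ergodic_mean gamma (x ^~ w) k) - b| : R^o)
     =O_\oo (fun k => (Num.sqrt (partial_sum gamma k))^-1 : R^o)}.
Proof.
have [fp fc _] := f_ccp; have [gp gc _] := g_ccp; have [hp hc _] := h_ccp.
have dom_sub : dom h `<=` dom f := f_smooth.1.
have f_diff v : dom h v -> differentiable (fine \o f : Hp -> R^o) v.
  by have [_ [C0 [_ [CC0 _] [_ df] _ _]]] := f_smooth => /CC0/df[].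
have [K K_ge0 descent] := FZ_smooth_descent hp hc zeta_ge0 f_smooth.
have [r _ C_bound] := weakly_compact_bounded C_weakly_compact.
have [M subM] : exists M : R, forall v, dom h v ->
    dom g (T v) /\ exists2 u, subdifferential g (T v) u & `|u| <= M.
  move: subdiff_bounded; set S := ereal_sup _ => Sfin.
  exists (fine S) => v hv; have gTv := TC_dom_subdiff v hv.
  split; first exact: subdifferential_fin gTv.
  exists (min_norm_element (subdifferential g (T v))).
    exact: min_norm_elementP.
  have leS : (`|min_norm_element (subdifferential g (T v))|%:E <= S)%E.
    by apply: ereal_sup_ubound; exists v.
  by rewrite -lee_fin fineK// fin_numE -ltNye -ltey Sfin (lt_le_trans (ltNyr _) leS).
have [xs [mus saddle]] := has_saddle_point.
have [v0 hv0] : dom h !=set0 := hp.2.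
have [hxs Axs] := saddle_point_feasible fp gp hp
  (ex_intro _ v0 (And3 (dom_sub _ hv0) (subM _ hv0).1 hv0)) saddle.
have gamma_gt0 k : 0 < gamma k by have /andP[] := gamma01 k.
have ell1_sums (u : nat -> R) : ell1_plus u -> bounded_sums u.
  by move=> [u0 /(cvg_series_bounded_sums u0)].
have gamma2_sum := bounded_sums_sqr beta_gt0 beta_nonincreasing
  (ell1_sums _ gamma2_beta_ell1).
have errors (X : nat -> Omega -> R) : (forall k w, 0 <= X k w) ->
    (forall k, measurable_fun [set: Omega] (X k)) ->
    summable_cond_expectation P (history (x 0%N) (mu 0%N) shat)
      (fun k => gamma k.+1) (fun k w => X k.+1 w) ->
    {ae P, forall w, bounded_sums (fun k => gamma k * X k w)}.
  move=> X0 mX sumX.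
  (* the error at step k + 1 is controlled given the history up to k; the first
     error is a single finite term *)
  have : {ae P, forall w, bounded_sums (fun k => gamma k.+1 * X k.+1 w)}.
    apply: (@conditional_summable _ _ _ P (history (x 0%N) (mu 0%N) shat)
      _ _ (fun k => gamma k.+1) (fun k w => X k.+1 w)) => //.
    - by move=> k; exact: history_measurable.
    - by move=> i k; exact: history_nondecreasing.
    - by move=> k; exact: ltW.
  by apply: filterS => w; exact: bounded_sums_of_succ.
have lam_ae := errors (fun k w => `|lam k w|) (fun k w => normr_ge0 _)
  (fun k => norm_measurable (lam_measurable k)) lam_summable.
have lams_ae := errors lams lams_ge0 lams_measurable lams_summable.
have residual_sum : {ae P, forall w,
    bounded_sums (fun k => gamma k * `|A (x k w) - b| ^+ 2)}.
  near=> w; apply: (infeasibility_bounded_sums f_ccp g_ccp h_ccp T_bounded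
    A_bounded dom_sub f_diff K_ge0 descent C_bound subM hxs Axs beta_gt0 gamma01
    (ell1_sums _ zeta_gamma_ell1) (ell1_sums _ gamma2_beta_ell1)
    (ell1_sums _ gamma_beta_ell1) beta_nonincreasing rho_nondecreasing
    rho_inf_gt0 rho_bounds M_inf_gt0 M_sup_gt0 gamma_ratio c_gt0 theta_def
    c_large (x_icgalp w)).
  - by near: w; exact: lam_ae.
  - by near: w; exact: lams_ae.
split; [|split; [split|]]; move: residual_sum; apply: filterS => w a_sum.
- have [Q Q0 incr] := infeasibility_increment h_ccp A_bounded C_bound hxs Axs
    gamma01 (x_icgalp w).
  exact: (residual_cvg0 gamma_gt0 gamma_not_ell1 a_sum Q0 gamma2_sum incr).
- exact: (inf_residual_rate gamma_gt0 a_sum).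
- exact: (frequently_small_residual gamma_gt0 gamma_not_ell1 a_sum).
- under eq_fun do rewrite ergodic_mean_residual//.
  exact: (mean_residual_rate gamma_gt0 a_sum).
Unshelve. all: by end_near. Qed.
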